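(* Let $d$ be a positive integer and let $G$ be an $n$-vertex $\Delta$-critical graph with minimum degree at least $d$ and maximum degree $\Delta=\Delta(G)\ge (d+2)^{5d+10}$. Then $\alpha(G)<\frac{7n}{12}$ if $d=3$; $\alpha(G)<\frac{4n}{7}$ if $d=4$; and $\alpha(G)<\frac{d+2+\sqrt[3]{(d-1)d}}{2d+4+\sqrt[3]{(d-1)d}}\,n$ if $d\ge 19$.
   Context: All graphs are finite and simple. $\Delta(G)$ is the maximum degree, $\chi'(G)$ the chromatic index, and $\alpha(G)$ the independence number of $G$. A graph $G$ is $\Delta$-critical if $G$ is connected, $\chi'(G)=\Delta(G)+1$, and $\chi'(G-e)=\Delta(G)$ for every edge $e\in E(G)$. *)

(* Defs.v *)
From HB Require Import structures.
From mathcomp Require Import all_boot.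

Set Implicit Arguments.
Unset Strict Implicit.
Unset Printing Implicit Defensive.

(* A finite simple graph on the vertex set [T] is a symmetric irreflexive
   relation [e : rel T]; the two properties are hypotheses of the theorems, not
   of the definitions below. *)
Section Graph.
Variable T : finType.
Implicit Types (e : rel T) (A B : {set T}).

Definition edges e : {set {set T}} :=
  [set [set p.1; p.2] | p in [pred p : T * T | e p.1 p.2]].

Definition degree e (x : T) : nat := #|[set y | e x y]|.

Definition max_degree e : nat := \max_(x : T) degree e x.

(* [#|T|] exceeds every degree, so it does not affect the minimum as soon as
   there is a vertex. *)
Definition min_degree e : nat := \big[minn/#|T|]_(x : T) degree e x.

Definition graph_connected e : bool :=
  (0 < #|T|) && [forall x, forall y, connect e x y].

Definition independent e (S : {set T}) : bool :=
  [forall x in S, forall y in S, ~~ e x y].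

Definition independence_number e : nat :=
  \max_(S : {set T} | independent e S) #|S|.

Definition edge_type e := {A : {set T} | A \in edges e}.

(* Two distinct edges are adjacent when they share an endpoint. *)
Definition proper_edge_coloring e k (c : {ffun edge_type e -> 'I_k}) : bool :=
  [forall A : edge_type e, forall B : edge_type e,
    (A != B) && (val A :&: val B != set0) ==> (c A != c B)].

Definition edge_colorable e (k : nat) : bool :=
  [exists c : {ffun edge_type e -> 'I_k}, proper_edge_coloring c].

Lemma edge_colorable_ex e : exists k, edge_colorable e k.
Proof.
exists #|{: edge_type e}|; apply/existsP; exists [ffun A => enum_rank A].
apply/forallP => A; apply/forallP => B; apply/implyP => /andP[neqAB _].
by rewrite !ffunE (inj_eq enum_rank_inj).
Qed.

Definition chromatic_index e : nat := ex_minn (edge_colorable_ex e).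

Definition delete_edge e A : rel T := [rel x y | e x y && ([set x; y] != A)].

Definition Delta_critical e : Prop :=
  [/\ graph_connected e,
      chromatic_index e = (max_degree e).+1
    & forall A, A \in edges e ->
        chromatic_index (delete_edge e A) = max_degree e].

End Graph.

(* Main.v *)
Require Import Defs.
From mathcomp Require Import all_boot all_order all_algebra.
From mathcomp Require Import reals exp.
From mathcomp Require Import perm zify ring lra.

Set Implicit Arguments.
Unset Strict Implicit.
Unset Printing Implicit Defensive.

(* In a coloring of [G - xy], exchanging colors along Kempe chains lets the
   uncolored edge [xy] move to [xv] whenever some neighbor [z] of [y] of small
   degree satisfies [color(yz) = color(xv)]. Following such moves, each color
   present at [x] is seen on an edge to a vertex of small degree from at most
   one reachable neighbor of [x], so in the reachable set [R] the total number
   of small-degree neighbors other than [x] is at most [|R| - 2]. Hence many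
   neighbors of [x] have no small-degree neighbor but [x].

   The bound on [alpha(G)] is obtained by discharging: each vertex [y] sends
   charge at most [1 + eps] to its neighbors, in such a way that every vertex
   receives at least [1]; the constant in the theorem is
   [(1 + eps) / (2 + eps)]. Vertices of degree at most [Delta / 4] are paid
   thanks to the above estimate. For those of larger degree, Kempe changes have
   only a bounded number of exceptions, which are negligible because [Delta]
   is huge. *)

(** * Kempe chains and partial colorings *)

(** The edges of two given colors form paths and cycles. A vertex missing one of the two colors is
    an end, and no component has three ends: this is how every exchange is kept under control. A
    vertex is [low] when its degree is at most [Delta - Delta / N], with [N = 12 (d + 2)]. The
    exceptions met at larger degrees number at most [516 N^5], and the hypothesis on [Delta] enters
    as [Delta >= 4900 N^6]. Beyond a base charge [1 / Delta] per neighbor, vertices of degree above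
    [Delta / 4] cost a vertex at most [2 / (N - 1)] out of [eps]. For [d >= 19], [eps] is
    [r / (d + 2)] with [r] the cube root in the statement, and half of it would be enough. For
    [d = 3, 4], [eps = 2 / (d + 2)] has no slack: a vertex of degree [d], with [d - 2] neighbors
    having one other neighbor of small degree each, gets [eps ((d - 2) / 2 + 2) = 1], so a loss
    independent of [Delta] cannot be afforded. But then the closure estimate is an equality, which
    forces a gap in the degrees around that vertex. The loss per neighbor falls to [1 / Delta], and
    the base charge [d / Delta] makes up for it. *)

Section Ends.
Variables (T : finType) (k : rel T).
Hypothesis k_deg2 : forall u v1 v2 v3, k u v1 -> k u v2 -> k u v3 ->
  [|| v1 == v2, v1 == v3 | v2 == v3].
Hypothesis k_sym : symmetric k.

Definition end_vertex u := forall v1 v2, k u v1 -> k u v2 -> v1 = v2.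

(** With at most two neighbors everywhere, a walk that does not turn back has no choice, and at an
    end vertex it cannot go on. So neither walk stops before the other. *)
Lemma forced_walk p q t u : k t u -> path k u p -> path k u q ->
  uniq [:: t, u & p] -> uniq [:: t, u & q] ->
  end_vertex (last u p) -> end_vertex (last u q) -> last u p = last u q.
Proof.
elim: p q t u => [|b p IH] [|a q] t u ktu //=.
- move=> _ /andP[kua _] _; rewrite !inE !negb_or => /andP[/and3P[_ tNa _] _].
  by move=> /(_ t a); rewrite k_sym ktu kua => /(_ isT isT) Eta; rewrite Eta eqxx in tNa.
- move=> /andP[kub _] _; rewrite !inE !negb_or => /andP[/and3P[_ tNb _] _] _ _.
  by move=> /(_ t b); rewrite k_sym ktu kub => /(_ isT isT) Eta; rewrite Eta eqxx in tNb.
move=> /andP[kub pp] /andP[kua pq] Up Uq.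
have Eab : a = b.
  have := k_deg2 kua kub (etrans (k_sym u t) ktu).
  move: Up Uq; rewrite !inE !negb_or => /andP[/and3P[_ tNb _] _] /andP[/and3P[_ tNa _] _].
  by rewrite (eq_sym a t) (eq_sym b t) (negPf tNa) (negPf tNb) !orbF => /eqP.
rewrite Eab in Uq pq *; apply: (IH q u b kub pp pq).
  by case/andP: Up.
by case/andP: Uq.
Qed.

(** Both walks must leave the end [u] along its single edge, and from there they are forced. *)
Lemma three_ends u v w : end_vertex u -> end_vertex v -> end_vertex w ->
  u != v -> u != w -> connect k u v -> connect k u w -> v = w.
Proof.
move=> eu ev ew uNv uNw /connectP[p0 pp0 Ev] /connectP[q0 pq0 Ew].
rewrite Ev in ev uNv *; rewrite Ew in ew uNw *.
case/shortenP: pp0 ev uNv => p pp Up _ ev uNv.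
case/shortenP: pq0 ew uNw => q pq Uq _ ew uNw.
case: p pp Up ev uNv => [|b p] /=; first by rewrite eqxx.
case: q pq Uq ew uNw => [|a q] /=; first by rewrite eqxx.
move=> /andP[kua pq] Uq ew _ /andP[kub pp] Up ev _.
rewrite (eu _ _ kua kub) in pq Uq ew *.
exact: forced_walk kub pp pq Up Uq ev ew.
Qed.

End Ends.

(** * Double counting and averaging over colors *)

Section Counting.
Variables (I C : finType).
Implicit Types (A : {set I}) (B : {set C}) (F : I -> {set C}).

Lemma sum_card_incidence A F :
  \sum_(v in A) #|F v| = \sum_(b : C) #|[set v in A | b \in F v]|.
Proof.
rewrite (eq_bigr (fun v => \sum_(b : C) (b \in F v : nat))); last first.
  by move=> v _; rewrite -sum1_card big_mkcond; apply: eq_bigr => b _; case: (b \in _).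
rewrite exchange_big; apply: eq_bigr => b _ /=.
rewrite -sum1_card big_mkcond [RHS]big_mkcond; apply: eq_bigr => v _.
by rewrite inE; case: (v \in A); case: (b \in _).
Qed.

Lemma sum_card_disjoint A B F : (forall v, v \in A -> F v \subset B) ->
  (forall v v' b, v \in A -> v' \in A -> b \in F v -> b \in F v' -> v = v') ->
  \sum_(v in A) #|F v| <= #|B|.
Proof.
move=> FB disj; rewrite sum_card_incidence -sum1_card [leqRHS]big_mkcond /=.
apply: leq_sum => b _; case: ifPn => [_|bB].
  apply/card_le1_eqP => v v'; rewrite !inE => /andP[vA bv] /andP[v'A bv'].
  exact: (disj _ _ b v'A vA bv' bv).
rewrite leqn0 cards_eq0; apply/eqP/setP => v; rewrite !inE.
by apply/negbTE; apply: contra bB => /andP[vA bv]; apply: subsetP (FB v vA) _ bv.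
Qed.

(** Averaging over [C]. It finds one color that treats many indices alike; [B] collects colors that
    later recolorings have to leave in place. *)
Lemma popular_element A B F n : 0 < #|A| -> 0 < #|C| ->
  (forall v, v \in A -> #|C| <= n * #|F v :\: B|) ->
  exists2 b, b \notin B & #|A| <= n * #|[set v in A | b \in F v]|.
Proof.
move=> A0 C0 FA; have [v0 v0A] := card_gt0P A0.
have [b0 b0P] : exists b0, b0 \in F v0 :\: B.
  by apply/card_gt0P; have := leq_trans C0 (FA _ v0A); rewrite muln_gt0 => /andP[].
have b0B : b0 \notin B by move: b0P; rewrite inE => /andP[].
pose p b := #|[set v in A | b \in F v]|.
have [b bB bmax] := @arg_maxnP _ b0 [pred b | b \notin B] p b0B; exists b; first exact: bB.
rewrite -(leq_pmul2l C0).
have sumF : #|C| * #|A| <= n * \sum_(v in A) #|F v :\: B|.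
  by rewrite mulnC -sum_nat_const big_distrr; apply: leq_sum => v; apply: FA.
apply: leq_trans sumF _; rewrite mulnCA leq_mul2l; apply/orP; right.
rewrite sum_card_incidence -sum_nat_const; apply: leq_sum => b' _.
have [b'B|b'B] := boolP (b' \in B).
  rewrite (_ : [set _ in _ | _] = set0) ?cards0 //.
  by apply/setP => v; rewrite !inE b'B andbF.
apply: leq_trans (bmax b' b'B); rewrite /p; apply: subset_leq_card.
by apply/subsetP => v; rewrite !inE b'B.
Qed.

End Counting.

(** * Partial edge colorings and color exchanges *)

Section PartialColorings.
Variables (T C : finType).
Implicit Types (g : T -> T -> option C) (D : rel T) (a b : C) (K : {set T}).

(** Colors sit on ordered pairs, with [None] off the domain [D]. Uncoloring, moving and exchanging
    colors then never change the type of a coloring. *)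
Definition partial_coloring D g :=
  [/\ forall u v, g u v = g v u,
      forall u v w a, g u v = Some a -> g u w = Some a -> v = w
    & forall u v, isSome (g u v) = D u v].

Definition miss g u : {set C} := [set a | [forall v, g u v != Some a]].

Lemma missP g u a : reflect (forall v, g u v <> Some a) (a \in miss g u).
Proof.
rewrite inE; apply: (iffP forallP) => h v; first by apply/eqP/h.
by apply/eqP/h.
Qed.

Lemma missPn g u a : a \notin miss g u -> exists v, g u v = Some a.
Proof. by rewrite inE negb_forall => /existsP[v /negPn/eqP]; exists v. Qed.

Lemma card_miss D g u : partial_coloring D g -> #|miss g u| + #|[set v | D u v]| = #|C|.
Proof.
case=> _ gP gD; rewrite -(cardC (mem (miss g u))); congr (_ + _).
case: (set_0Vmem [set v | D u v]) => [E0|[v0]].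
  rewrite E0 cards0; apply/esym/eq_card0 => a; rewrite inE /=.
  apply/negbTE/negP => /missPn[v gv]; have := gD u v; rewrite gv /= => Dv.
  by move/setP/(_ v): E0; rewrite !inE -Dv.
rewrite inE -gD; case Ev0: (g u v0) => [a0|] // _.
rewrite -(@card_in_imset _ _ (fun v => odflt a0 (g u v)) [set v | D u v]); last first.
  move=> v w; rewrite !inE -!gD; case Ev: (g u v) => [a|] //; case Ew: (g u w) => [b|] //.
  by move=> _ _ /= Eab; rewrite -Eab in Ew; apply: gP Ev Ew.
apply: eq_card => a; rewrite [in RHS]inE /=; apply/imsetP/idP => [[v]|].
  rewrite inE -gD; case Ev: (g u v) => [b|] // _ /= ->.
  by apply/negP => /missP/(_ v).
move/missPn=> [v Ev]; exists v; rewrite ?inE -?gD Ev //.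
Qed.

Definition kempe g a b : rel T := [rel u v | (g u v == Some a) || (g u v == Some b)].

Definition kcomp g a b u : {set T} := [set v | connect (kempe g a b) u v].

Definition kclosed g a b K := forall u v, kempe g a b u v -> (u \in K) = (v \in K).

(** The exchange is decided at the first endpoint, so the result is symmetric only for a [kclosed]
    set [K], that is, a union of chains. *)
Definition kswap g K a b : T -> T -> option C :=
  fun u v => if u \in K then omap (tperm a b) (g u v) else g u v.

Lemma kempe_sym D g a b : partial_coloring D g -> symmetric (kempe g a b).
Proof. by case=> gS _ _ u v; rewrite /kempe /= gS. Qed.

Lemma kempe_deg2 D g a b : partial_coloring D g -> forall u v1 v2 v3, 
  kempe g a b u v1 -> kempe g a b u v2 -> kempe g a b u v3 ->
  [|| v1 == v2, v1 == v3 | v2 == v3].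
Proof.
case=> _ gP _ u v1 v2 v3.
by move=> /orP[]/eqP E1 /orP[]/eqP E2 /orP[]/eqP E3;
  rewrite ?(gP _ _ _ _ E1 E2) ?(gP _ _ _ _ E1 E3) ?(gP _ _ _ _ E2 E3) ?eqxx ?orbT.
Qed.

Lemma kempe_end D g a b u : partial_coloring D g -> (a \in miss g u) || (b \in miss g u) ->
  end_vertex (kempe g a b) u.
Proof.
case=> _ gP _ /orP[]/missP m v1 v2 /orP[]/eqP E1 /orP[]/eqP E2;
  by [case: (m _ E1) | case: (m _ E2) | apply: gP E1 E2].
Qed.

Lemma kcomp_closed D g a b u : partial_coloring D g -> kclosed g a b (kcomp g a b u).
Proof.
move=> gV v w kvw; rewrite !inE; apply/idP/idP => cu; apply: connect_trans cu (connect1 _) => //.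
by rewrite (kempe_sym _ _ gV).
Qed.

Lemma kclosedC g a b K : kclosed g a b K -> kclosed g a b (~: K).
Proof. by move=> KC u v /KC; rewrite !inE => ->. Qed.

Lemma kswap_coloring D g a b K : partial_coloring D g -> kclosed g a b K -> partial_coloring D (kswap g K a b).
Proof.
move=> [gS gP gD] KC; split.
- move=> u v; rewrite /kswap gS.
  case: (boolP (kempe g a b u v)) => [/KC ->//|].
  rewrite /kempe /= gS; case: (g v u) => [c|] /=; last by case: ifP; case: ifP.
  rewrite negb_or => /andP[ac bc]; rewrite tpermD ?if_same //.
  - by apply: contra ac => /eqP->.
  - by apply: contra bc => /eqP->.
- move=> u v w c; rewrite /kswap; case: ifP => _; last exact: gP.
  case Ev: (g u v) => [c1|] //; case Ew: (g u w) => [c2|] //= [<-] [/perm_inj E].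
  by apply: gP Ev _; rewrite Ew E.
- by move=> u v; rewrite -gD /kswap; case: ifP => //; case: (g u v).
Qed.

Lemma kswap_other g K a b c u v : c != a -> c != b ->
  (kswap g K a b u v == Some c) = (g u v == Some c).
Proof.
move=> ca cb; rewrite /kswap; case: ifP => // _; case: (g u v) => [c'|] //=.
rewrite !(inj_eq Some_inj) -[LHS](inj_eq (@perm_inj _ (tperm a b))) tpermK.
by rewrite tpermD // eq_sym.
Qed.

Lemma kswap_out g K a b u v : u \notin K -> kswap g K a b u v = g u v.
Proof. by rewrite /kswap => /negPf->. Qed.

Lemma kswap_missl g K a b u : u \in K -> a \in miss g u -> b \in miss (kswap g K a b) u.
Proof.
move=> uK /missP m; apply/missP => v; rewrite /kswap uK.
case E: (g u v) => [c|] //= [Ec]; apply: (m v).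
by rewrite E -(tpermK a b c) Ec tpermR.
Qed.

Lemma kswap_missr g K a b u : u \in K -> b \in miss g u -> a \in miss (kswap g K a b) u.
Proof.
move=> uK /missP m; apply/missP => v; rewrite /kswap uK.
case E: (g u v) => [c|] //= [Ec]; apply: (m v).
by rewrite E -(tpermK a b c) Ec tpermL.
Qed.

Lemma eq_miss g g' u a : (forall v, (g' u v == Some a) = (g u v == Some a)) ->
  (a \in miss g' u) = (a \in miss g u).
Proof. by move=> E; rewrite !inE; apply: eq_forallb => v; rewrite E. Qed.

Definition same_edge (u v s t : T) := (s == u) && (t == v) || (s == v) && (t == u).

Definition set_color g u v o : T -> T -> option C :=
  fun s t => if same_edge u v s t then o else g s t.

Lemma same_edgeC u v s t : same_edge u v s t = same_edge u v t s.
Proof. by rewrite /same_edge orbC ![(t == _) && _]andbC. Qed.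

Lemma set_color_coloring D g u v a : u != v -> partial_coloring D g -> a \in miss g u -> a \in miss g v ->
  partial_coloring [rel s t | D s t || same_edge u v s t] (set_color g u v (Some a)).
Proof.
move=> uv [gS gP gD] /missP mu /missP mv; split.
- by move=> s t; rewrite /set_color same_edgeC gS.
- have end_miss s t : same_edge u v s t -> forall w, g s w <> Some a.
    by move=> /orP[]/andP[/eqP-> _].
  move=> s t w c; rewrite /set_color.
  case: ifP => E1; case: ifP => E2; last exact: gP.
  + move: E1 E2 => /orP[]/andP[/eqP-> /eqP->] /orP[]/andP[/eqP Euv /eqP->] _ _ //;
      by rewrite Euv eqxx in uv.
  + by move=> [<-] /(end_miss _ _ E1).
  + by move=> + [Ea]; rewrite -Ea => /(end_miss _ _ E2).
- by move=> s t; rewrite /set_color /= -gD; case: ifP => _ /=; rewrite ?orbT ?orbF.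
Qed.

Lemma unset_color_coloring D g u v : partial_coloring D g ->
  partial_coloring [rel s t | D s t && ~~ same_edge u v s t] (set_color g u v None).
Proof.
move=> [gS gP gD]; split.
- by move=> s t; rewrite /set_color same_edgeC gS.
- by move=> s t w c; rewrite /set_color; do 2!case: ifP => // _; exact: gP.
- by move=> s t; rewrite /set_color /= -gD; case: ifP => _ /=; rewrite ?andbF ?andbT.
Qed.

Lemma eq_partial_coloring D D' g : D =2 D' -> partial_coloring D g -> partial_coloring D' g.
Proof. by move=> E [gS gP gD]; split=> // u v; rewrite gD E. Qed.

End PartialColorings.

(** * Edge colorings of a critical graph minus an edge *)

Section Low.
Variables (T : finType) (e : rel T) (D N : nat).

(** The deficiency is at least [D / N], written without division. When [D] is the number of colors,
    a low vertex misses at least a fraction [1 / N] of them. *)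
Definition low z := D <= N * (D - degree e z).

Definition lows v := [set w | e v w && low w].

End Low.

Section Critical.
Variables (T C : finType) (e : rel T).
Hypothesis e_sym : symmetric e.
Hypothesis e_irr : irreflexive e.
Hypothesis e_uncolorable : forall g : T -> T -> option C, ~ partial_coloring e g.
Hypothesis degC : forall u, degree e u <= #|C|.
Implicit Types (g : T -> T -> option C) (a b c : C).

Definition minus_edge (x y : T) : rel T := [rel u v | e u v && ~~ same_edge x y u v].
Notation valid x y := (partial_coloring (minus_edge x y)).

Lemma valid_sym x y g : valid x y g -> forall u v, g u v = g v u.
Proof. by case. Qed.

Lemma valid_proper x y g : valid x y g -> forall u v w a,
  g u v = Some a -> g u w = Some a -> v = w.
Proof. by case. Qed.

Lemma valid_dom x y g u v : valid x y g ->
  isSome (g u v) = e u v && ~~ same_edge x y u v.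
Proof. by case=> _ _ ->. Qed.

Lemma valid_edge x y g u v a : valid x y g -> g u v = Some a -> e u v.
Proof. by move=> gV E; have := valid_dom u v gV; rewrite E => /esym/andP[]. Qed.

Lemma valid_root x y g : valid x y g -> g x y = None.
Proof.
move=> gV; have := valid_dom x y gV; rewrite /same_edge !eqxx andbF.
by case: (g x y).
Qed.

Lemma valid_some x y g u v : valid x y g -> e u v -> ~~ same_edge x y u v ->
  exists a, g u v = Some a.
Proof.
move=> gV euv n; have := valid_dom u v gV; rewrite euv n.
by case: (g u v) => [a|] // _; exists a.
Qed.

Lemma no_common_miss x y g a : e x y -> valid x y g ->
  a \in miss g x -> a \in miss g y -> False.
Proof.
move=> exy gV ax ay; apply: (e_uncolorable (g := set_color g x y (Some a))).
have xy : x != y by apply: contraTneq exy => ->; rewrite e_irr.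
apply: eq_partial_coloring (set_color_coloring xy gV ax ay) => s t; rewrite /minus_edge /=.
case: (boolP (same_edge x y s t)); rewrite ?andbT ?orbF // andbF /=.
by move=> /orP[]/andP[/eqP-> /eqP->]; rewrite // e_sym.
Qed.

(** Otherwise an exchange on the chain through [y] makes [a] missing at both ends of the uncolored
    edge, which could then be colored. *)
Lemma kempe_linked x y g c a : e x y -> valid x y g ->
  c \in miss g y -> a \in miss g x -> connect (kempe g c a) y x.
Proof.
move=> exy gV cy ax; apply/negPn/negP => nyx.
have KC := kcomp_closed (a := c) (b := a) y gV.
have yK : y \in kcomp g c a y by rewrite inE.
have xK : x \notin kcomp g c a y by rewrite inE.
have ay := kswap_missl a yK cy.
apply: (no_common_miss (a := a) exy (kswap_coloring gV KC) _ ay).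
by rewrite (@eq_miss _ _ g) // => v; rewrite kswap_out.
Qed.

(* Exchanges the role of the color [c] missing at [y] with the color [a]
   missing at [x]; both lie on one Kempe chain, so any third vertex
   missing one of the two colors is off that chain. *)
Lemma exchange x y g c a : e x y -> valid x y g ->
  c \in miss g y -> a \in miss g x -> exists g', [/\ valid x y g',
    a \in miss g' y, c \in miss g' x,
    forall b, b != c -> b != a -> forall s t, (g' s t == Some b) = (g s t == Some b)
  & forall z, z != x -> z != y -> (c \in miss g z) || (a \in miss g z) ->
      forall t, g' z t = g z t].
Proof.
move=> exy gV cy ax.
have xy : x != y by apply: contraTneq exy => ->; rewrite e_irr.
have lyx := kempe_linked exy gV cy ax.
have KC := kcomp_closed (a := c) (b := a) y gV.
exists (kswap g (kcomp g c a y) c a); split.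
- exact: kswap_coloring.
- by apply: kswap_missl => //; rewrite inE.
- by apply: kswap_missr => //; rewrite inE.
- by move=> b bc ba s t; rewrite kswap_other.
move=> z zx zy mz t; rewrite kswap_out // inE; apply/negP => lyz.
have := three_ends (kempe_deg2 gV) (kempe_sym c a gV)
  (kempe_end gV _) (kempe_end gV _) (kempe_end gV mz) _ _ lyx lyz.
rewrite cy ax orbT eq_sym xy (eq_sym y) zy => /(_ isT isT isT isT) Exz.
by rewrite Exz eqxx in zx.
Qed.

Lemma recolor x y g z j a : valid x y g -> z != x -> g y z = Some j ->
  a \in miss g y -> a \in miss g z ->
  exists g', [/\ valid x y g', j \in miss g' y,
    forall s t, ~~ same_edge y z s t -> g' s t = g s t
    & forall b, b != a -> b != j -> forall s t, (g' s t == Some b) = (g s t == Some b)].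
Proof.
move=> gV zx gyz ay az.
have eyz := valid_edge gV gyz.
have yz : y != z by apply: contraTneq eyz => ->; rewrite e_irr.
exists (set_color g y z (Some a)); split.
- apply: eq_partial_coloring (set_color_coloring yz gV ay az) => s t; rewrite /minus_edge /=.
  case: (boolP (same_edge y z s t)) => [st|]; rewrite ?orbF // orbT; apply/esym.
  move: st => /orP[]/andP[/eqP-> /eqP->]; rewrite ?eyz ?(e_sym z) ?eyz /= /same_edge;
  by rewrite (negPf zx) ?andbF ?orbF /= ?(eq_sym z) ?(negPf yz) ?andbF.
- apply/missP => t; rewrite /set_color; case: ifP => [_ [E]|].
    by move/missP: ay => /(_ z); rewrite E gyz.
  move=> + E; rewrite /same_edge eqxx /= (valid_proper gV E gyz).
  by rewrite eqxx.
- by move=> s t n; rewrite /set_color (negPf n).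
move=> b ba bj s t; rewrite /set_color; case: ifP => // st.
have -> : g s t = Some j.
  by move: st => /orP[]/andP[/eqP-> /eqP->] //; rewrite (valid_sym gV).
by apply/eqP/eqP => -[E]; [rewrite E eqxx in ba | rewrite E eqxx in bj].
Qed.

Lemma shift x y g v j : e x y -> valid x y g -> g x v = Some j -> j \in miss g y ->
  exists g', [/\ valid x v g', g' x y = Some j, j \in miss g' v,
   forall s t, ~~ same_edge x v s t -> ~~ same_edge x y s t -> g' s t = g s t
   & forall b, b != j -> forall s t, (g' s t == Some b) = (g s t == Some b)].
Proof.
move=> exy gV gxv jy.
have exv := valid_edge gV gxv.
have xy : x != y by apply: contraTneq exy => ->; rewrite e_irr.
have xv : x != v by apply: contraTneq exv => ->; rewrite e_irr.
have yv : y != v.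
  by apply: contra_eqN (valid_root gV) => /eqP->; rewrite gxv.
pose g1 := set_color g x v None.
have g1V := unset_color_coloring x v gV.
have jx : j \in miss g1 x.
  apply/missP => t; rewrite /g1 /set_color; case: ifP => // + E.
  by rewrite /same_edge eqxx (valid_proper gV E gxv) eqxx.
have jy1 : j \in miss g1 y.
  apply/missP => t; rewrite /g1 /set_color; case: ifP => // _.
  by move/missP: jy.
exists (set_color g1 x y (Some j)); split.
- apply: eq_partial_coloring (set_color_coloring xy g1V jx jy1) => s t; rewrite /minus_edge /=.
  case: (boolP (same_edge x y s t)) => st; rewrite /= ?orbF ?andbT // orbT; apply/esym.
  move: st => /orP[]/andP[/eqP-> /eqP->]; rewrite ?exy ?(e_sym y) ?exy /= /same_edge;
  by rewrite (negPf yv) ?(negPf xv) ?andbF.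
- by rewrite /set_color /same_edge !eqxx.
- apply/missP => t; rewrite /set_color /g1 /set_color /same_edge.
  rewrite !(eq_sym v) (negPf xv) (negPf yv) eqxx /=; case: ifP => [//|/negbT tx].
  rewrite (valid_sym gV) => E; have E2 := gxv; rewrite (valid_sym gV) in E2.
  rewrite (valid_sym gV) in E.
  by rewrite (valid_proper gV E E2) eqxx in tx.
- by move=> s t n1 n2; rewrite /set_color (negPf n2) /g1 /set_color (negPf n1).
move=> b bj s t; rewrite /set_color; case: ifP => st.
  have -> : g s t = None; last by apply/eqP => -[E]; rewrite E eqxx in bj.
  have R := valid_root gV.
  by move: st => /orP[]/andP[/eqP-> /eqP->] //; rewrite (valid_sym gV).
rewrite /g1 /set_color; case: ifP => // st2.
have -> : g s t = Some j.
  by move: st2 => /orP[]/andP[/eqP-> /eqP->] //; rewrite (valid_sym gV).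
by apply/esym/eqP => -[E]; rewrite E eqxx in bj.
Qed.

Lemma other_miss g g' b u : (forall s t, (g' s t == Some b) = (g s t == Some b)) ->
  (b \in miss g' u) = (b \in miss g u).
Proof. by move=> E; apply: eq_miss => v; rewrite E. Qed.

Lemma root_neighborP x y g v a : valid x y g -> g x v = Some a -> v != y.
Proof. by move=> gV E; apply: contra_eqN (valid_root gV) => /eqP<-; rewrite E. Qed.

Lemma card_miss_root x y g u : valid x y g -> #|C| <= #|miss g u| + degree e u.
Proof.
move=> gV; rewrite -(card_miss u gV) leq_add2l; apply: subset_leq_card.
by apply/subsetP => v; rewrite !inE => /andP[].
Qed.

Lemma miss_root_gt0 x y g : e x y -> valid x y g ->
  exists c, c \in miss g y.
Proof.
move=> exy gV; apply/set0Pn; rewrite -card_gt0.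
have := card_miss y gV; suff : #|[set v | minus_edge x y y v]| < degree e y by have := degC y; lia.
apply: proper_card; apply/properP; split.
  by apply/subsetP => v; rewrite !inE => /andP[].
by exists x; rewrite !inE 1?e_sym // /minus_edge /= /same_edge !eqxx orbT andbF.
Qed.

(** An exchange that does not touch [z] makes [a] missing at [y]. Recoloring [yz] with [a] then
    frees [b] at [y], where [xy] is waiting for a color missing at [x]. *)
Lemma fan x y g z b a : e x y -> valid x y g -> z != x -> g y z = Some b ->
  b \in miss g x -> a \in miss g x -> a \in miss g z -> False.
Proof.
move=> exy gV zx gyz bx ax az.
have [c cy] := miss_root_gt0 exy gV.
have eyz := valid_edge gV gyz.
have zy : z != y by apply: contraTneq eyz => ->; rewrite e_irr.
have bc : b != c by apply: contraTneq cy => <-; apply/negP => /missP/(_ z).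
have ba : b != a.
  by apply: contraTneq az => <-; apply/negP => /missP/(_ y); rewrite (valid_sym gV).
have [g1 [g1V ay cx1 oth1 off1]] := exchange exy gV cy ax.
have off := off1 z zx zy _; rewrite az orbT in off; have {}off := off isT.
have gyz1 : g1 y z = Some b by apply/eqP; rewrite oth1 // gyz.
have az1 : a \in miss g1 z by rewrite (@eq_miss _ _ g) // => v; rewrite off.
have [g2 [g2V by2 off2 _]] := recolor g1V zx gyz1 ay az1.
apply: (no_common_miss exy g2V _ by2); apply/missP => t gxt.
have := bx; rewrite -(@other_miss g g1) //; last by move=> s t'; rewrite oth1.
move=> /missP/(_ t); rewrite -off2 //; apply/negP => /orP[]/andP[/eqP E].
  by move: exy; rewrite E e_irr.
by move=> _; rewrite E eqxx in zx.
Qed.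

(** One move of the uncolored edge: [a] is made missing at [y], [yz] is recolored with it, and [xv]
    hands its color [j] to [xy]. Only [c], [a], [j] are disturbed, and [j] is lost on [xv] and [yz]
    only; sequences of moves depend on this bookkeeping. *)
Lemma step x y g z v c a j : e x y -> valid x y g -> c \in miss g y ->
  a \in miss g x -> z != x -> a \in miss g z -> g y z = Some j -> g x v = Some j ->
  exists g', [/\ valid x v g', j \in miss g' v, c \in miss g' x,
    forall b, b != c -> b != a -> b != j -> forall s t, (g' s t == Some b) = (g s t == Some b)
  & forall s t, g s t = Some j -> ~~ same_edge x v s t -> ~~ same_edge y z s t -> g' s t = Some j].
Proof.
move=> exy gV cy ax zx az gyz gxv.
have eyz := valid_edge gV gyz.
have xy : x != y by apply: contraTneq exy => ->; rewrite e_irr.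
have zy : z != y by apply: contraTneq eyz => ->; rewrite e_irr.
have jc : j != c by apply: contraTneq cy => <-; apply/negP => /missP/(_ z).
have ja : j != a by apply: contraTneq ax => <-; apply/negP => /missP/(_ v).
have [g1 [g1V ay cx1 oth1 off1]] := exchange exy gV cy ax.
have off := off1 z zx zy _; rewrite az orbT in off; have {}off := off isT.
have gyz1 : g1 y z = Some j by apply/eqP; rewrite oth1 // gyz.
have az1 : a \in miss g1 z by rewrite (@eq_miss _ _ g) // => t; rewrite off.
have [g2 [g2V by2 off2 oth2]] := recolor g1V zx gyz1 ay az1.
have offx t : g2 x t = g1 x t.
  apply: off2; apply/negP => /orP[]/andP[/eqP E _]; first by rewrite E eqxx in xy.
  by rewrite E eqxx in zx.
have gxv2 : g2 x v = Some j by rewrite offx; apply/eqP; rewrite oth1 // gxv.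
have [g3 [g3V g3xy g3j off3 oth3]] := shift exy g2V gxv2 by2.
exists g3; split=> //.
- rewrite (@other_miss g2 g3); last by move=> s t; rewrite oth3 // eq_sym.
  by rewrite (@eq_miss _ _ g1) // => t; rewrite offx.
- by move=> b bc ba bj s t; rewrite oth3 // oth2 // oth1.
move=> s t gst n1 n2.
have n3 : ~~ same_edge x y s t.
  apply/negP => st; suff : g s t = None by rewrite gst.
  by move: st => /orP[]/andP[/eqP-> /eqP->]; rewrite ?(valid_root gV) // (valid_sym gV) (valid_root gV).
by rewrite off3 // off2 //; apply/eqP; rewrite oth1 // gst.
Qed.

Lemma common_color (A B : {set C}) b : #|C| + 1 < #|A| + #|B| ->
  exists a, [/\ a \in A, a \in B & a != b].
Proof.
move=> AB; have [a] : exists a, a \in (A :&: B) :\ b.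
  apply/set0Pn; rewrite -card_gt0.
  have cUI : #|A :|: B| + #|A :&: B| = #|A| + #|B| := cardsUI A B.
  have cU : #|A :|: B| <= #|C| := max_card _.
  have cD : #|A :&: B| = (b \in A :&: B) + #|(A :&: B) :\ b| := cardsD1 b _.
  by have : (b \in A :&: B) <= 1 := leq_b1 _; lia.
by rewrite !inE => /and3P[ab aA aB]; exists a.
Qed.

Lemma common_color3 (A B E : {set C}) : 2 * #|C| + 1 < #|A| + #|B| + #|E| ->
  exists a, [/\ a \in A, a \in B & a \in E].
Proof.
move=> ABE; have cUI : #|B :|: E| + #|B :&: E| = #|B| + #|E| := cardsUI B E.
have cU : #|B :|: E| <= #|C| := max_card _.
have [b _|C0] := pickP (mem C); last first.
  have cA : #|A| <= #|C| := max_card _.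
  have cI : #|B :&: E| <= #|C| := max_card _; have Z : #|C| = 0 by apply: eq_card0.
  lia.
have [|a [aA]] := @common_color A (B :&: E) b; first lia.
by rewrite inE => /andP[aB aE] _; exists a.
Qed.

(** * Moving the uncolored edge around a fixed vertex *)

Section Paths.
Hypothesis e_crit : forall u v, e u v -> exists g, valid u v g.
Variable x : T.

(** The bound leaves at least two colors missing at both [x] and [z], so that one can be chosen
    different from any prescribed color. *)
Definition admissible z := (z != x) && (degree e z + degree e x + 2 <= #|C|).

Lemma admissible_color y g z b : valid x y g -> admissible z ->
  exists a, [/\ a \in miss g x, a \in miss g z & a != b].
Proof.
move=> gV /andP[_ zC]; apply: common_color.
have := card_miss_root x gV; have := card_miss_root z gV; lia.
Qed.

Lemma admissible_nonadjacent z : admissible z -> ~~ e x z.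
Proof.
move=> za; apply/negP => exz; have [g gV] := e_crit exz.
have [c cz] := miss_root_gt0 exz gV.
by have [a [ax az _]] := admissible_color c gV za; apply: no_common_miss exz gV ax az.
Qed.

(** An arc from [u] to [v] says that the uncolored edge, once at [xu], can be moved to [xv] by
    [step]. The last conjunct rules out the equality of two absent colors. *)
Definition shift_rel g : rel T :=
  [rel u v | [exists z, [&& admissible z, g u z == g x v & isSome (g x v)]]].

Lemma shift_relP g u v : shift_rel g u v -> exists z j, [/\ admissible z, g u z = Some j & g x v = Some j].
Proof.
move=> /existsP[z /and3P[za /eqP E]]; case Ev: (g x v) => [j|] // _.
by exists z, j; rewrite E.
Qed.

Lemma shift_relI g u v z j : admissible z -> g u z = Some j -> g x v = Some j -> shift_rel g u v.
Proof. by move=> za E1 E2; apply/existsP; exists z; rewrite za E1 E2 eqxx. Qed.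

Lemma path_shift_rel_other g g' (B : pred C) u p :
  (forall b, b \notin B -> forall s t, (g' s t == Some b) = (g s t == Some b)) ->
  (forall v b, v \in p -> g x v = Some b -> b \notin B) ->
  path (shift_rel g) u p -> path (shift_rel g') u p.
Proof.
move=> oth; elim: p u => //= v p IH u pB /andP[/shift_relP[z [j [za E1 E2]]] pp].
have jB : j \notin B by apply: pB E2; rewrite mem_head.
apply/andP; split.
  by apply: (shift_relI za (j := j)); apply/eqP; rewrite oth // ?E1 ?E2.
by apply: IH pp => w b wp; apply: pB; rewrite inE wp orbT.
Qed.

Lemma path_shift_rel_some g u p v : path (shift_rel g) u p -> v \in p -> exists b, g x v = Some b.
Proof.
elim: p u => //= w p IH u /andP[/shift_relP[z [j [_ _ E]]] pp].
by rewrite inE => /predU1P[->|]; [exists j | apply: IH pp].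
Qed.

(* By induction on [p]: shifting the uncolored edge along [p] ends at a fan
   centered at [last y p], and keeps all colors that do not occur at [x] on
   the way. *)
Lemma path_color n g y p w b : size p <= n -> valid x y g -> e x y ->
  path (shift_rel g) y p -> uniq (y :: p) -> admissible w -> g (last y p) w = Some b ->
  [/\ b \notin miss g x, b \notin miss g y & forall v, v \in p -> g x v <> Some b].
Proof.
elim: n g y p w b => [|n IH] g y p w b.
  rewrite leqn0 size_eq0 => /eqP-> gV exy _ _ wa /= gyw; split=> //.
    apply/negP => bx; have [a [ax aw _]] := admissible_color b gV wa.
    by case/andP: wa => wx _; apply: fan exy gV wx gyw bx ax aw.
  by apply/negP => /missP/(_ w).
case: p => [|v p] pn.
  by apply: (IH g y [::]).
(* The color of [xu] also appears on an edge from the predecessor of [u] to an admissible vertex, so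
   the induction hypothesis for the shorter path applies to it. *)
have prefix g0 u : valid x y g0 -> e x y -> path (shift_rel g0) y (v :: p) ->
    uniq (y :: v :: p) -> u \in v :: p -> forall b0, g0 x u = Some b0 -> b0 \notin miss g0 y.
  move=> gV exy pp Up up b0 E.
  have {}pn : size (v :: p) <= n.+1 by [].
  case/splitPr: up pn pp Up => p1 p2; rewrite size_cat /= => pn.
  rewrite cat_path cat_uniq mem_cat negb_or /=.
  move=> /and3P[pp1 /shift_relP[z [j [za E1 E2]]] _] /andP[/andP[yp1 _] /andP[Up1 _]].
  have Up : uniq (y :: p1) by rewrite /= yp1.
  have sp1 : size p1 <= n.
    by rewrite addnS ltnS in pn; apply: leq_trans pn; apply: leq_addr.
  by move: E2; rewrite E => -[E2]; have [] := IH g0 y p1 z b0 sp1 gV exy pp1 Up za; rewrite ?E1 ?E2.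
have pn' : size p <= n by [].
have not_j g0 u j : valid x y g0 -> uniq (y :: v :: p) -> u \in p -> g0 x v = Some j ->
    forall b0, g0 x u = Some b0 -> b0 != j.
  move=> gV Up up E b0 E0; apply: contraTneq up => Eb; rewrite Eb in E0.
  by rewrite (valid_proper gV E0 E); case/and3P: Up.
(* If [b0] were missing at [x], it would remain so after one move to [xv], against the induction
   hypothesis for the rest [p] of the path, now rooted at [v]. *)
have caseM g0 w0 b0 : valid x y g0 -> e x y -> path (shift_rel g0) y (v :: p) ->
    uniq (y :: v :: p) -> admissible w0 -> g0 (last v p) w0 = Some b0 -> b0 \notin miss g0 x.
  move=> gV exy pp Up wa gw; apply/negP => bx.
  have [c cy] := miss_root_gt0 exy gV.
  have pre := prefix _ _ gV exy pp Up.
  case/andP: (pp) => /shift_relP[z [j [za gyz gxv]]] pp'.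
  have [a [ax az ab]] := admissible_color b0 gV za.
  have zx : z != x by case/andP: za.
  have [g1 [g1V jv cx oth _]] := step exy gV cy ax zx az gyz gxv.
  have pp1 : path (shift_rel g1) v p.
    apply: (path_shift_rel_other (B := [pred t | t \in [:: c; a; j]]) _ _ pp').
      by move=> t; rewrite !inE !negb_or => /and3P[tc ta tj] s s'; rewrite oth.
    move=> u t up E; rewrite !inE !negb_or; apply/and3P; split.
    - by apply: contraTneq cy => <-; apply: pre E; rewrite inE up orbT.
    - by apply: contraTneq ax => <-; apply/negP => /missP/(_ u).
    - exact: not_j gV Up up gxv _ E.
  have bc : b0 != c.
    by apply: contraTneq bx => ->; apply/negP => cx'; apply: no_common_miss exy gV cx' cy.
  have bj : b0 != j by apply: contraTneq bx => ->; apply/negP => /missP/(_ v).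
  have ba : b0 != a by rewrite eq_sym.
  have gw1 : g1 (last v p) w0 = Some b0 by apply/eqP; rewrite oth // gw.
  have Up' : uniq (v :: p) by case/andP: Up.
  have [] := IH g1 v p w0 b0 pn' g1V (valid_edge gV gxv) pp1 Up' wa gw1.
  by rewrite (other_miss _ (oth b0 bc ba bj)) bx.
move=> gV exy pp Up wa gw.
have pre := prefix _ _ gV exy pp Up.
have wx : w != x by case/andP: wa.
have wy : w != y by apply: contraTneq exy => <-; apply: admissible_nonadjacent.
have bM := caseM _ _ _ gV exy pp Up wa gw.
(* An exchange carries a color missing at [y] over to [x], which is the case just excluded. *)
have bY : b \notin miss g y.
  apply/negP => by_; have [a [ax aw ab]] := admissible_color b gV wa.
  have [g1 [g1V ay bx oth off]] := exchange exy gV by_ ax.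
  have {}off := off w wx wy _; rewrite aw orbT in off; have {}off := off isT.
  apply/negP: bx; apply: (caseM g1 w) => //; last first.
    by rewrite (valid_sym g1V) off (valid_sym gV).
  apply: (path_shift_rel_other (B := [pred t | t \in [:: b; a]]) _ _ pp).
    by move=> t; rewrite !inE !negb_or => /andP[tb ta] s s'; rewrite oth.
  move=> u t up E; rewrite !inE !negb_or; apply/andP; split.
  - by apply: contraTneq by_ => <-; apply: pre E.
  - by apply: contraTneq ax => <-; apply/negP => /missP/(_ u).
split=> // u up gxu.
have [c cy] := miss_root_gt0 exy gV.
case/andP: (pp) => /shift_relP[z [j [za gyz gxv]]] pp'.
have [a [ax az ab]] := admissible_color b gV za.
have zx : z != x by case/andP: za.
have [g1 [g1V jv cx oth jkeep]] := step exy gV cy ax zx az gyz gxv.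
have exv := valid_edge gV gxv.
have pp1 : path (shift_rel g1) v p.
  apply: (path_shift_rel_other (B := [pred t | t \in [:: c; a; j]]) _ _ pp').
    by move=> t; rewrite !inE !negb_or => /and3P[tc ta tj] s s'; rewrite oth.
  move=> u' t up' E; rewrite !inE !negb_or; apply/and3P; split.
  - by apply: contraTneq cy => <-; apply: pre E; rewrite inE up' orbT.
  - by apply: contraTneq ax => <-; apply/negP => /missP/(_ u').
  - exact: not_j gV Up up' gxv _ E.
have Up' : uniq (v :: p) by case/andP: Up.
have bc : b != c by apply: contraNneq bY => ->.
have ba : b != a by rewrite eq_sym.
have bj' : b = j -> g1 (last v p) w = Some b.
  move=> Eb; rewrite Eb; apply: jkeep; first by rewrite -Eb.
    apply/negP => /orP[]/andP[/eqP E1 /eqP E2]; last by rewrite E2 eqxx in wx.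
    have : x \in v :: p by rewrite -E1 mem_last.
    move=> /(path_shift_rel_some pp)[b0]; have := valid_dom x x gV.
    by rewrite e_irr; case: (g x x).
  apply/negP => /orP[]/andP[/eqP E1 /eqP E2].
    by case/andP: Up; rewrite -E1 mem_last.
  by rewrite E2 eqxx in wy.
(* After the move, [j] is missing at the new root [v]. This excludes [b = j]; any other [b] has kept
   its edges. *)
case: (eqVneq b j) => [Eb|bj].
  have [_ + _] := IH g1 v p w b pn' g1V exv pp1 Up' wa (bj' Eb).
  by rewrite Eb jv.
have up' : u \in p.
  by move: up; rewrite inE => /predU1P[Eu|//]; move: gxu bj; rewrite Eu gxv => -[->]; rewrite eqxx.
have gw1 : g1 (last v p) w = Some b by apply/eqP; rewrite oth // gw.
have [_ _] := IH g1 v p w b pn' g1V exv pp1 Up' wa gw1.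
by move=> /(_ u up'); apply; apply/eqP; rewrite oth // gxu.
Qed.

(** If the chain through [x] avoided [w], exchanging along it would make [b] missing at [x] and keep
    the edge from the end of the path to [w]. The path survives too, because neither [a] nor [b]
    occurs on its edges at [x]. *)
Lemma root_facts g y v w b : valid x y g -> e x y -> connect (shift_rel g) y v ->
  admissible w -> g v w = Some b ->
  [/\ b \notin miss g x, b \notin miss g y
    & forall a, a \in miss g x -> a \in miss g w -> connect (kempe g b a) x w].
Proof.
move=> gV exy /connectP[p0 pp0 ->]; case/shortenP: pp0 => p pp Up _ wa gw.
have [bx by_ bp] := path_color (leqnn _) gV exy pp Up wa gw.
split=> // a ax aw; apply/negPn/negP => nxw.
have KC := kcomp_closed (a := b) (b := a) x gV.
pose g1 := kswap g (kcomp g b a x) b a.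
have g1V : valid x y g1 by apply: kswap_coloring.
have bx1 : b \in miss g1 x by apply: kswap_missr => //; rewrite inE.
have gw1 : g1 (last y p) w = Some b.
  by rewrite (valid_sym g1V) /g1 kswap_out ?inE // (valid_sym gV).
have pp1 : path (shift_rel g1) y p.
  apply: (path_shift_rel_other (B := [pred t | t \in [:: b; a]]) _ _ pp).
    by move=> t; rewrite !inE !negb_or => /andP[tb ta] s s'; rewrite /g1 kswap_other.
  move=> u t up E; rewrite !inE !negb_or; apply/andP; split.
  - by apply/eqP => Et; apply: (bp u up); rewrite -Et.
  - by apply: contraTneq ax => <-; apply/negP => /missP/(_ u).
by have [] := path_color (leqnn _) g1V exy pp1 Up wa gw1; rewrite bx1.
Qed.

(** A vertex reached from [k] is handled by first shifting the uncolored edge to [xk], which makes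
    [k] the root. Only the color [c] moves, and among the edges at [x] it was carried by [xk]
    alone. *)
Lemma closure_facts g y k c v w b : valid x y g -> e x y ->
  c \in miss g y -> g x k = Some c ->
  connect (shift_rel g) y v || connect (shift_rel g) k v -> admissible w -> g v w = Some b ->
  [/\ b \notin miss g x, b != c
    & forall a, a \in miss g x -> a \in miss g w -> connect (kempe g b a) x w].
Proof.
move=> gV exy cy gxk /orP[yv|kv] wa gw.
  have [bx by_ ba] := root_facts gV exy yv wa gw; split=> //.
  by apply: contraNneq by_ => ->.
have exk := valid_edge gV gxk.
have [f [fV fxy ck off oth]] := shift exy gV gxk cy.
have wx : w != x by case/andP: wa.
have {}kv : connect (shift_rel f) k v.
  move: kv => /connectP[p0 pp0 ->]; case/shortenP: pp0 => p pp Up _.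
  apply/connectP; exists p => //.
  apply: (path_shift_rel_other (B := pred1 c) _ _ pp); first exact: oth.
  move=> u t up E; apply: contraTneq up => Et; rewrite Et in E.
  by rewrite (valid_proper gV E gxk); case/andP: Up.
have missx a : (a \in miss f x) = (a \in miss g x).
  case: (eqVneq a c) => [->|ac]; last exact: other_miss (oth _ ac).
  by apply/idP/idP => /missP => [/(_ y)|/(_ k)]; rewrite ?fxy ?gxk.
have vx : v != x.
  apply: contraTneq kv => ->; apply/negP => /connectP[p pp Ex].
  have : x \in k :: p by rewrite Ex mem_last.
  rewrite inE => /predU1P[Exk|]; first by rewrite -Exk e_irr in exk.
  move=> /(path_shift_rel_some pp)[b0]; have := valid_dom x x fV.
  by rewrite e_irr; case: (f x x).
have fw : f v w = Some b.
  by rewrite off //; apply/negP => /orP[]/andP[/eqP E1 /eqP E2];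
    move: vx wx; rewrite ?E1 ?E2 eqxx.
have [bx bk ba] := root_facts fV exk kv wa fw.
have bc : b != c by apply: contraNneq bk => ->.
split=> //; first by rewrite -missx.
move=> a ax aw; have ac : a != c.
  by apply: contraTneq ax => ->; apply/negP => /missP/(_ k).
have -> : connect (kempe g b a) x w = connect (kempe f b a) x w.
  by apply: eq_connect => s t; rewrite /kempe /= !oth.
by apply: ba; rewrite ?missx // (other_miss _ (oth _ ac)).
Qed.

Definition low_nbrs lo v := [set z | [&& e v z, z != x & degree e z <= lo]].

(* [R] is the set of neighbors to which the uncolored edge [xy] can be shifted,
   starting either from [y] or from the [k] such that [color(xk)] is missing at
   [y]. The edges counted by the sum have distinct colors, which all occur at
   [x] on edges to [R] other than [xy] and [xk]. *)
Lemma closure_bound lo mi y : e x y -> degree e x + lo + mi + 2 <= #|C| -> lo <= mi ->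
  exists R : {set T}, [/\ y \in R, {in R, forall v, e x v}
   & \sum_(v in R) #|low_nbrs lo v| + 2 +
     [exists v in R, [exists w, [&& e v w, w != x & lo < degree e w <= mi]]] <= #|R|].
Proof.
move=> exy klm lm; have [g gV] := e_crit exy.
have [c cy] := miss_root_gt0 exy gV.
have [k gxk] : exists k, g x k = Some c.
  by apply/missPn/negP => cx; apply: no_common_miss exy gV cx cy.
have exk := valid_edge gV gxk.
pose R := [set v | connect (shift_rel g) y v || connect (shift_rel g) k v].
have kNy : k != y := root_neighborP gV gxk.
have RN : {in R, forall v, e x v}.
  move=> v; rewrite inE => /orP[]/connectP[p pp ->].
    case/lastP: p pp => [|p u] //= pp; rewrite last_rcons.
    have [|b E] := path_shift_rel_some (v := u) pp; first by rewrite mem_rcons mem_head.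
    exact: valid_edge gV E.
  case/lastP: p pp => [|p u] //= pp; rewrite last_rcons.
  have [|b E] := path_shift_rel_some (v := u) pp; first by rewrite mem_rcons mem_head.
  exact: valid_edge gV E.
have yR : y \in R by rewrite inE connect0.
have kR : k \in R by rewrite inE connect0 orbT.
have admissibleI z : z != x -> degree e z <= mi -> admissible z by rewrite /admissible => ->; lia.
pose col v z := odflt c (g v z).
have colE v z : v \in R -> e v z -> z != x -> g v z = Some (col v z).
  move=> /RN exv evz zx; rewrite /col.
  have [|a ->] // := valid_some gV evz.
  apply/negP => /orP[]/andP[/eqP E1 /eqP E2]; last by rewrite E2 eqxx in zx.
  by rewrite E1 e_irr in exv.
pose Col v := [set col v z | z in low_nbrs lo v].
pose F := [set col x v | v in R :\: [set y; k]].
have cardF : #|F| + 2 <= #|R|.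
  have c1 : #|F| <= #|R :\: [set y; k]| := leq_imset_card _ _.
  have c2 : #|R :&: [set y; k]| + #|R :\: [set y; k]| = #|R| := cardsID _ _.
  have c3 : R :&: [set y; k] = [set y; k].
    by apply/setIidPr/subsetP => v; rewrite !inE => /orP[]/eqP->; rewrite connect0 ?orbT.
  by move: c2; rewrite c3 cards2 eq_sym kNy => <-; rewrite addnC leq_add2l.
have inF v w : v \in R -> e v w -> w != x -> degree e w <= mi -> col v w \in F.
  move=> vR evw wx dw; have wa := admissibleI _ wx dw.
  have gw := colE _ _ vR evw wx.
  have vR' := vR; rewrite inE in vR'.
  have [bx bc _] := closure_facts gV exy cy gxk vR' wa gw.
  have [u gxu] := missPn bx; apply/imsetP; exists u; last by rewrite {2}/col gxu.
  have uNy := root_neighborP gV gxu.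
  have uNk : u != k by apply: contraNneq bc => Eu; move: gxu; rewrite Eu gxk => -[->].
  rewrite !inE negb_or uNy uNk /=; have vu := connect1 (shift_relI wa gw gxu).
  by case/orP: vR' => /connect_trans/(_ vu) ->; rewrite ?orbT.
(* Some color [a] is missing at [x], [w] and [w']; the chain from [x] in [a] and the common color of
   the two edges ends at both [w] and [w']. The degree budget allows only one of them to exceed
   [lo]. *)
have disj v w v' w' : v \in R -> e v w -> w != x -> degree e w <= lo ->
    v' \in R -> e v' w' -> w' != x -> degree e w' <= mi ->
    col v w = col v' w' -> v = v' /\ w = w'.
  move=> vR evw wx dw v'R ev'w' w'x dw' E.
  have gw := colE _ _ vR evw wx; have gw' := colE _ _ v'R ev'w' w'x.
  have vR' := vR; have v'R' := v'R; rewrite !inE in vR' v'R'.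
  have wa := admissibleI _ wx (leq_trans dw lm); have w'a := admissibleI _ w'x dw'.
  have [bx bc cw] := closure_facts gV exy cy gxk vR' wa gw.
  have [_ _ cw'] := closure_facts gV exy cy gxk v'R' w'a gw'.
  have [a [ax aw aw']] : exists a, [/\ a \in miss g x, a \in miss g w & a \in miss g w'].
    apply: common_color3; move: (card_miss_root x gV) (card_miss_root w gV).
    by move: (card_miss_root w' gV) dw dw' klm; clear; lia.
  have ends u : a \in miss g u -> end_vertex (kempe g (col v w) a) u.
    by move=> au; apply: kempe_end gV _; rewrite au orbT.
  have Eww : w = w'.
    apply: (three_ends (@kempe_deg2 _ _ _ _ (col v w) a gV) (kempe_sym _ _ gV) (ends x ax)
      (ends w aw) (ends w' aw') _ _ (cw a ax aw)); rewrite 1?eq_sym // E.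
    exact: cw' a ax aw'.
  split=> //; rewrite -E -Eww in gw'.
  by apply: (valid_proper gV (u := w)); rewrite (valid_sym gV); [exact: gw | exact: gw'].
have cardCol v : v \in R -> #|low_nbrs lo v| = #|Col v|.
  move=> vR; rewrite card_in_imset // => z z'; rewrite !inE.
  move=> /and3P[evz zx dz] /and3P[evz' zx' dz'] E.
  by have [] := disj v z v z' vR evz zx dz vR evz' zx' (leq_trans dz' lm) E.
pose x0 := [exists v in R, [exists w, [&& e v w, w != x & lo < degree e w <= mi]]].
(* An edge to a vertex of degree between [lo] and [mi] uses up one more color of [F], different from
   all colors counted by the sum. *)
have [F' [F'F F'card F'in]] : exists F' : {set C}, [/\ F' \subset F, #|F'| + x0 <= #|F|
    & forall v b, v \in R -> b \in Col v -> b \in F'].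
  have ColF v b : v \in R -> b \in Col v -> b \in F.
    move=> vR /imsetP[z]; rewrite inE => /and3P[evz zx dz] ->.
    by apply: inF => //; apply: leq_trans lm.
  case: (boolP x0) => [/existsP[v /andP[vR /existsP[w /and3P[evw wx /andP[lw wm]]]]]|_].
    exists (F :\ col v w); split; first exact: subD1set.
      by rewrite (cardsD1 (col v w) F) inF // addnC.
    move=> v' b v'R bC; rewrite !inE (ColF v') // andbT.
    move: bC => /imsetP[z]; rewrite inE => /and3P[evz zx dz] ->.
    apply/eqP => E; have [_ Ez] := disj _ _ _ _ v'R evz zx dz vR evw wx wm E.
    by move: dz; rewrite Ez leqNgt lw.
  by exists F; split=> //; rewrite addn0.
exists R; split=> //; suff : \sum_(v in R) #|low_nbrs lo v| <= #|F'|.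
  rewrite -/x0 => S; move: S F'card cardF; clear; lia.
rewrite (eq_bigr (fun v => #|Col v|)) //; apply: sum_card_disjoint.
  by move=> v vR; apply/subsetP => b; apply: F'in.
move=> v v' b vR v'R /imsetP[z]; rewrite inE => /and3P[evz zx dz] Eb /imsetP[z'].
rewrite inE => /and3P[evz' zx' dz'] Eb'.
have [|->] // := disj _ _ _ _ vR evz zx dz v'R evz' zx' (leq_trans dz' lm).
by rewrite -Eb -Eb'.
Qed.

(* At most one vertex missing [h] lies on the chain through [x], so
   exchanging [h] and [a] off that chain makes all the others miss [a]. *)
Lemma off_swap y g h a : valid x y g -> a \in miss g x ->
  exists g' w0, [/\ valid x y g', forall v, g' x v = g x v,
    forall b, b != h -> b != a -> forall s t, (g' s t == Some b) = (g s t == Some b)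
  & forall w, w != x -> w != w0 -> h \in miss g w -> a \in miss g' w].
Proof.
move=> gV ax; pose K := ~: kcomp g h a x.
have KC : kclosed g h a K by apply/kclosedC/(kcomp_closed _ gV).
pose w0 := odflt x [pick w | [&& w != x, h \in miss g w & connect (kempe g h a) x w]].
exists (kswap g K h a), w0; split.
- exact: kswap_coloring.
- by move=> v; rewrite kswap_out // !inE connect0.
- by move=> b bh ba s t; rewrite kswap_other.
move=> w wx; rewrite /w0; case: pickP => [w1 /and3P[w1x hw1 xw1]|none] /= wNw hw.
  apply: kswap_missl (hw); rewrite !inE; apply/negP => xw.
  suff E : w = w1 by rewrite E eqxx in wNw.
  have ends u : (h \in miss g u) || (a \in miss g u) -> end_vertex (kempe g h a) u.
    exact: kempe_end gV.
  apply: (three_ends (@kempe_deg2 _ _ _ _ h a gV) (kempe_sym _ _ gV) (ends x _)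
    (ends w _) (ends w1 _) _ _ xw xw1); by rewrite ?ax ?hw ?hw1 ?orbT // 1?eq_sym.
by apply: kswap_missl (hw); rewrite !inE; apply/negP => xw; have := none w; rewrite wx hw xw.
Qed.

(** The possible second leaves of a Vizing fan centered at [y] whose first leaf is [x]. *)
Definition fan_nbrs g y := [set w | (w != x) && [exists b, (b \in miss g x) && (g y w == Some b)]].

Lemma fan_nbrsP g y w : reflect (w != x /\ exists2 b, b \in miss g x & g y w = Some b)
  (w \in fan_nbrs g y).
Proof.
rewrite inE; apply: (iffP andP) => -[wx h]; split=> //.
  by case/existsP: h => b /andP[bx /eqP E]; exists b.
by case: h => b bx E; apply/existsP; exists b; rewrite bx E eqxx.
Qed.

Lemma fan_miss y g w b : e x y -> valid x y g -> w \in fan_nbrs g y ->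
  b \in miss g w -> b \notin miss g x.
Proof.
move=> exy gV /fan_nbrsP[wx [c cx E]] bw; apply/negP => bx.
exact: fan exy gV wx E cx bx bw.
Qed.

(** Suppose both miss [h], and exchange [h] with a color [a] missing at [x], off the chain through
    [x]. At most one of [w], [w'] is an exception, so the other one misses [a], against [fan]. Three
    colors missing at [x] let [a] differ from the colors of [yw] and [yw']. *)
Lemma fan_disjoint y g w w' h : e x y -> valid x y g -> 2 < #|miss g x| ->
  w \in fan_nbrs g y -> w' \in fan_nbrs g y -> h \in miss g w -> h \in miss g w' -> w = w'.
Proof.
move=> exy gV M2 wF w'F hw hw'; apply/eqP/negPn/negP => ww'.
have hx := fan_miss exy gV wF hw.
move: wF w'F => /fan_nbrsP[wx [b bx E]] /fan_nbrsP[w'x [b' b'x E']].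
have [a] : exists a, a \in miss g x :\: [set b; b'].
  apply/card_gt0P; move: M2; rewrite -(cardsID [set b; b'] (miss g x)).
  have h2 : #|miss g x :&: [set b; b']| <= 2.
    by apply: leq_trans (subset_leq_card (subsetIr _ _)) _; rewrite cards2; case: eqP.
  by move: h2; clear; lia.
rewrite !inE negb_or => /andP[/andP[ab ab'] ax].
have {}ax : a \in miss g x by rewrite inE.
have [g' [w0 [g'V g'x oth aw]]] := off_swap h gV ax.
have g'm c : c \in miss g x -> c \in miss g' x by rewrite (@eq_miss _ _ g) // => v; rewrite g'x.
have key u c : u != x -> u != w0 -> h \in miss g u -> c \in miss g x -> c != a ->
    g y u = Some c -> False.
  move=> ux uw0 hu cx ca Eu; apply: (fan exy g'V ux _ (g'm _ cx) (g'm _ ax)).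
    apply/eqP; rewrite oth ?Eu //; apply: contraTneq hu => <-; apply/negP => /missP/(_ y).
    by rewrite (valid_sym gV).
  exact: aw.
have [Ew|wNw0] := eqVneq w w0; last by apply: (key w b) => //; rewrite eq_sym.
by apply: (key w' b') => //; rewrite 1?eq_sym // -Ew.
Qed.

Lemma card_missC y g : e x y -> valid x y g -> #|~: miss g x| < degree e x.
Proof.
move=> exy gV.
have E1 : #|miss g x| + #|~: miss g x| = #|C| := cardsC _.
have E2 := card_miss x gV; rewrite -E1 in E2; move/addnI: E2 => <-.
apply: proper_card; apply/properP; split.
  by apply/subsetP => v; rewrite !inE => /andP[].
by exists y; rewrite !inE // /minus_edge /= /same_edge !eqxx andbF.
Qed.

(** Deficient fan neighbors miss pairwise distinct colors present at [x]. The others, except [x],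
    are joined to [y] by distinct colors present at [x]. Fewer than [degree e x] colors are present
    there. *)
Lemma card_deficient_nbrs y : e x y -> degree e x + 2 < #|C| ->
  #|[set w | e y w && (degree e w < #|C|)]| <= 2 * degree e x.
Proof.
move=> exy xC; have [g gV] := e_crit exy.
have cM := card_missC exy gV.
have M2 : 2 < #|miss g x|.
  have E1 : #|miss g x| + #|~: miss g x| = #|C| := cardsC _.
  by move: E1 cM xC; clear; lia.
pose D := [set w | e y w && (degree e w < #|C|)].
have cF : #|D :&: fan_nbrs g y| <= #|~: miss g x|.
  apply: leq_trans (sum_card_disjoint (A := D :&: fan_nbrs g y) (F := miss g) _ _).
  - rewrite -sum1_card; apply: leq_sum => w; rewrite !inE => /andP[/andP[_ dw] _].
    by have := card_miss_root w gV; move: dw; clear; lia.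
  - move=> w; rewrite inE => /andP[_ wF]; apply/subsetP => b bw; rewrite inE.
    exact: fan_miss exy gV wF bw.
  - move=> w w' b; rewrite !in_setI => /andP[_ wF] /andP[_ w'F].
    exact: fan_disjoint exy gV M2 wF w'F.
have cN : #|D :\: fan_nbrs g y :\ x| <= #|~: miss g x|.
  have [c _] := miss_root_gt0 exy gV.
  have colE w : w \in D :\: fan_nbrs g y :\ x -> exists2 b, g y w = Some b & b \notin miss g x.
    rewrite !inE => /and3P[wx wF /andP[eyw _]].
    have [|b E] := valid_some gV eyw.
      apply/negP => /orP[]/andP[/eqP E1 /eqP E2]; last by rewrite E2 eqxx in wx.
      by rewrite E1 e_irr in exy.
    exists b => //; apply: contra wF => bx; rewrite wx; apply/existsP; exists b.
    by rewrite bx E eqxx.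
  rewrite -(@card_in_imset _ _ (fun w => odflt c (g y w))); last first.
    move=> w w' /colE[b E _] /colE[b' E' _]; rewrite E E' /= => Eb; rewrite -Eb in E'.
    exact: (valid_proper gV E E').
  apply: subset_leq_card; apply/subsetP => b /imsetP[w /colE[b' E b'x] ->].
  by rewrite E inE.
have E1 : #|D :&: fan_nbrs g y| + #|D :\: fan_nbrs g y| = #|D| := cardsID _ _.
have E2 : #|D :\: fan_nbrs g y| <= 1 + #|D :\: fan_nbrs g y :\ x|.
  by rewrite (cardsD1 x (D :\: _)) leq_add2r leq_b1.
rewrite -/D; move: E1 E2 cF cN cM; clear; lia.
Qed.

(** * Low vertices of larger degree, up to boundedly many exceptions *)

Section Rough.
Variable N : nat.

Notation low := (low e #|C| N).
Notation lows := (lows e #|C| N).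

Lemma low_card_miss y g z : valid x y g -> low z -> #|C| <= N * #|miss g z|.
Proof.
move=> gV zl; apply: leq_trans zl _; rewrite leq_mul2l; apply/orP; right.
by rewrite leq_subLR addnC; apply: card_miss_root gV.
Qed.

Definition movable g y c (zf : T -> T) (I : {set T}) :=
  [/\ valid x y g, c \in miss g y
    & forall v, v \in I -> exists2 j, g y (zf v) = Some j & g x v = Some j].

(** A color [h] missing at many [f v] is exchanged, off the chain through [x], with a color [a]
    missing at [x]. Two indices may be lost: one [f v] on that chain, and one [v] with [xv] colored
    [h]. The protected colors [Pr], at most 4, take at most half of the missing colors of a low
    vertex, whence [2 * N]. *)
Lemma enrich y c zf g I f (Pr : {set C}) : movable g y c zf I -> 0 < #|I| ->
  {in I &, injective f} -> (forall v, v \in I -> f v != x /\ low (f v)) ->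
  c \in Pr -> #|Pr| <= 4 -> 8 * N <= #|C| -> low x -> 0 < #|C| ->
  exists g' a (I' : {set T}), [/\ movable g' y c zf I', I' \subset I,
    #|I| <= 2 * N * (#|I'| + 2), forall v, g' x v = g x v
  & [/\ a \in miss g x, a \notin Pr, forall v, v \in I' -> a \in miss g' (f v)
      & forall b, b \in Pr -> forall s t, (g' s t == Some b) = (g s t == Some b)]].
Proof.
move=> [gV cy Ij] I0 finj fP cPr Pr4 NC xl C0.
have [h hPr Ih] : exists2 h, h \notin Pr &
    #|I| <= 2 * N * #|[set v in I | h \in miss g (f v)]|.
  apply: popular_element => // v vI; have [_ fl] := fP v vI.
  have fm := low_card_miss gV fl.
  have E1 : #|miss g (f v) :&: Pr| + #|miss g (f v) :\: Pr| = #|miss g (f v)| := cardsID _ _.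
  have E2 : #|miss g (f v) :&: Pr| <= #|Pr| := subset_leq_card (subsetIr _ _).
  move: fm E1 E2 NC Pr4; clear; nia.
have [a] : exists a, a \in miss g x :\: Pr.
  apply/card_gt0P.
  have E1 : #|miss g x :&: Pr| + #|miss g x :\: Pr| = #|miss g x| := cardsID _ _.
  have E2 : #|miss g x :&: Pr| <= #|Pr| := subset_leq_card (subsetIr _ _).
  have xm := low_card_miss gV xl.
  move: xm E1 E2 NC Pr4 C0; clear; nia.
rewrite in_setD => /andP[aPr ax].
have [g' [w0 [g'V g'x oth aw]]] := off_swap h gV ax.
pose I' := [set v in I | [&& h \in miss g (f v), f v != w0 & g x v != Some h]].
exists g', a, I'; split=> //.
- split=> //.
    rewrite (other_miss _ (oth c _ _)) //.
      by apply: contraNneq hPr => <-.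
    by apply: contraNneq aPr => <-.
  move=> v; rewrite inE => /and4P[vI _ _ xh]; have [j E1 E2] := Ij v vI.
  exists j; last by rewrite g'x.
  apply/eqP; rewrite oth ?E1 //.
    by apply: contra_neq xh => <-.
  by apply: contraTneq ax => <-; apply/negP => /missP/(_ v).
- by apply/subsetP => v; rewrite inE => /andP[].
- apply: leq_trans Ih _; rewrite leq_mul2l; apply/orP; right.
  have c1 : #|[set v in I | f v == w0]| <= 1.
    apply/card_le1_eqP => v v'; rewrite !inE => /andP[vI /eqP E] /andP[v'I /eqP E'].
    by apply: finj => //; rewrite E E'.
  have c2 : #|[set v in I | g x v == Some h]| <= 1.
    apply/card_le1_eqP => v v'; rewrite !inE => /andP[vI /eqP E] /andP[v'I /eqP E'].
    exact: (valid_proper gV E' E).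
  have c3 : [set v in I | h \in miss g (f v)] \subset
      I' :|: ([set v in I | f v == w0] :|: [set v in I | g x v == Some h]).
    apply/subsetP => v; rewrite !in_setU ![v \in [set _ in _ | _]]inE => /andP[-> ->] /=.
    by case: eqP; case: eqP.
  apply: leq_trans (subset_leq_card c3) _.
  apply: leq_trans (leq_card_setU _ _) _; rewrite leq_add2l.
  by apply: leq_trans (leq_card_setU _ _) _; apply: leq_add c1 c2.
split=> //.
  move=> v; rewrite inE => /and4P[vI hv vw0 _]; apply: aw => //.
  by have [] := fP v vI.
move=> b bPr s t; rewrite oth //.
  by apply: contraNneq hPr => <-.
by apply: contraNneq aPr => <-.
Qed.

(** The missing sets of fan neighbors are disjoint, and each contains at least a fraction [1 / N] of
    the colors. *)
Lemma card_low_fan y g (S : {set T}) : e x y -> valid x y g -> 2 < #|miss g x| ->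
  0 < #|C| -> (forall w, w \in S -> w \in fan_nbrs g y /\ low w) -> #|S| <= N.
Proof.
move=> exy gV M2 C0 SP; rewrite -(leq_pmul2r C0).
have sumS : \sum_(w in S) #|miss g w| <= #|[set: C]|.
  apply: sum_card_disjoint => [w wS|w w' b wS w'S]; first exact: subsetT.
  by apply: (fan_disjoint exy gV M2); case: (SP w wS) (SP w' w'S) => ? _ [? _].
rewrite cardsT in sumS; rewrite -(leq_pmul2l C0) in sumS.
apply: leq_trans (_ : N * \sum_(w in S) #|miss g w| <= _).
  rewrite -sum_nat_const big_distrr; apply: leq_sum => w wS.
  exact: low_card_miss gV (SP w wS).2.
by rewrite leq_mul2l -(leq_pmul2l C0) sumS orbT.
Qed.

(** Once the uncolored edge is moved to [xv], these vertices become fan neighbors of [v], except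
    possibly one joined by [a], a color that the move may bring to [x]. *)
Lemma card_low_colored_missing y g z v c a j : e x y -> valid x y g -> c \in miss g y ->
  a \in miss g x -> z != x -> a \in miss g z -> g y z = Some j -> g x v = Some j ->
  low x -> 8 * N <= #|C| -> 0 < #|C| ->
  #|[set w in lows v | (w != x) && [exists b in miss g x, g v w == Some b]]| <= N.+1.
Proof.
move=> exy gV cy ax zx az gyz gxv xl NC C0.
have [g' [g'V jv cx oth _]] := step exy gV cy ax zx az gyz gxv.
have exv := valid_edge gV gxv.
have M2 : 2 < #|miss g' x|.
  have := low_card_miss g'V xl; move: NC C0; clear; nia.
set S := [set w in _ | _]; pose Sa := [set w in S | g v w == Some a].
have cSa : #|Sa| <= 1.
  apply/card_le1_eqP => w w' /[!inE] /andP[_ /eqP E] /andP[_ /eqP E'].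
  exact: (valid_proper gV E' E).
have cS : #|S :\: Sa| <= N.
  apply: (card_low_fan exv g'V M2 C0) => w; rewrite in_setD => /andP[wSa wS].
  move: (wS); rewrite inE => /and3P[wl wx /existsP[b /andP[bx /eqP gb]]].
  split; last by move: wl; rewrite inE => /andP[].
  have ba : b != a by move: wSa; rewrite inE wS gb /=; apply: contraNneq => ->.
  have bc : b != c.
    by apply: contraTneq bx => ->; apply/negP => cx'; apply: no_common_miss exy gV cx' cy.
  have bj : b != j by apply: contraTneq bx => ->; apply/negP => /missP/(_ v).
  apply/fan_nbrsP; split=> //; exists b; first by rewrite (other_miss _ (oth b bc ba bj)).
  by apply/eqP; rewrite oth // gb.
have E1 : #|S :&: Sa| + #|S :\: Sa| = #|S| := cardsID _ _.
have E2 : #|S :&: Sa| <= #|Sa| := subset_leq_card (subsetIr _ _).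
by move: cSa cS E1 E2; clear; lia.
Qed.

Lemma movable_sub g y c zf (I I' : {set T}) :
  I' \subset I -> movable g y c zf I -> movable g y c zf I'.
Proof. by move=> /subsetP II' [gV cy h]; split=> // v /II'; apply: h. Qed.

(** The constant counts the [N + 1] neighbors joined by colors missing at [x], then [x] itself, then
    the color [c]. *)
Lemma colored_low_colors y g c v : e x y -> valid x y g -> e x v ->
  #|[set w in lows v | (w != x) && [exists b in miss g x, g v w == Some b]]| <= N.+1 ->
  #|lows v| <= N + 3 + #|[set l | [&& l != c, l \notin miss g x &
    [exists w in lows v, (w != x) && (g v w == Some l)]]]|.
Proof.
move=> exy gV exv; set S := [set w in _ | _]; set P := [set l | _] => cS.
have vx : v != x by apply: contraTneq exv => ->; rewrite e_irr.
pose Q := (lows v :\: S) :\ x.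
have QP w : w \in Q -> exists l, [/\ w \in lows v, w != x, g v w = Some l & l \notin miss g x].
  rewrite !in_setD in_set1 => /and3P[wx wS wl].
  have evw : e v w by move: wl; rewrite inE => /andP[].
  have [|l E] := valid_some gV evw.
    by apply/negP => /orP[]/andP[/eqP E1 /eqP E2]; [rewrite E1 eqxx in vx | rewrite E2 eqxx in wx].
  exists l; split=> //; apply: contra wS => lx; rewrite inE wl wx /=.
  by apply/existsP; exists l; rewrite lx E eqxx.
have cQ : #|Q| <= 1 + #|P|.
  rewrite -(@card_in_imset _ _ (fun w => odflt c (g v w))); last first.
    move=> w w' /QP[b [_ _ E _]] /QP[b' [_ _ E' _]]; rewrite E E' /= => Eb; rewrite -Eb in E'.
    exact: (valid_proper gV E E').
  have sub : [set odflt c (g v w) | w in Q] \subset c |: P.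
    apply/subsetP => l /imsetP[w /QP[l' [wl wx E lx]] ->].
    rewrite E /= !inE; case: eqP => //= _; rewrite -[~~ _]/(l' \notin miss g x) in lx *.
    move: lx; rewrite !inE => ->; apply/existsP; exists w.
    by rewrite wl wx E eqxx.
  apply: leq_trans (subset_leq_card sub) _; apply: leq_trans (leq_card_setU _ _) _.
  by rewrite cards1.
have E1 : #|lows v :&: S| + #|lows v :\: S| = #|lows v| := cardsID _ _.
have E2 : #|lows v :&: S| <= #|S| := subset_leq_card (subsetIr _ _).
have E3 : #|lows v :\: S| <= 1 + #|Q|.
  by rewrite (cardsD1 x (lows v :\: S)) leq_add2r leq_b1.
by move: cS cQ E1 E2 E3; clear; lia.
Qed.

(* The chain from [x] in the colors [l] and [a2] misses [wf v] or [wf v'], and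
   exchanging [l] and [a2] along it makes [l] missing at [x]. *)
Lemma two_sharing y g c zf I wf l a1 a2 a3 v v' : e x y -> movable g y c zf I ->
  v \in I -> v' \in I -> v != v' -> l != c -> l \notin miss g x -> uniq [:: a1; a2; a3] ->
  a1 \in miss g x -> a2 \in miss g x -> a3 \in miss g x ->
  (forall u, u \in I -> [/\ zf u != x, wf u != x, g u (wf u) = Some l,
     a1 \in miss g (zf u) & (a2 \in miss g (wf u)) && (a3 \in miss g (wf u))]) -> False.
Proof.
move=> exy [gV cy Ij] vI v'I vv' lc lx Ua a1x a2x a3x IP.
have [a12 a13 a23] : [/\ a1 != a2, a1 != a3 & a2 != a3].
  by move: Ua; rewrite /= !inE negb_or => /and3P[/andP[]].
have xl b : b \in miss g x -> l != b by move=> bx; apply: contraNneq lx => ->.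
have xc b : b \in miss g x -> b != c.
  by move=> bx; apply: contraTneq bx => ->; apply/negP => cx; apply: no_common_miss exy gV cx cy.
have link u : u \in I -> connect (kempe g l a2) x (wf u).
  move=> uI; have [zx wx gw a1z /andP[a2w a3w]] := IP u uI; have [j gz gxu] := Ij u uI.
  apply/negPn/negP => nxw.
  have KC := kcomp_closed (a := l) (b := a2) x gV.
  pose f := kswap g (kcomp g l a2 x) l a2.
  have fV : valid x y f by apply: kswap_coloring.
  have foth b : b != l -> b != a2 -> forall s t, (f s t == Some b) = (g s t == Some b).
    by move=> bl ba s t; rewrite /f kswap_other.
  have lfx : l \in miss f x by apply: kswap_missr => //; rewrite inE.
  have fw : f u (wf u) = Some l.
    by rewrite (valid_sym fV) /f kswap_out ?inE // (valid_sym gV).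
  have jl : j != l.
    apply: contra_neq wx => Ej; rewrite (valid_sym gV) Ej in gxu.
    exact: (valid_proper gV gw gxu).
  have xj b : b \in miss g x -> j != b.
    by move=> bx; apply: contraTneq bx => <-; apply/negP => /missP/(_ u).
  have lj : l != j by rewrite eq_sym.
  have [la1 la2 la3] : [/\ l != a1, l != a2 & l != a3] by rewrite !xl.
  have [cl ca2] : c != l /\ c != a2 by rewrite !(eq_sym c) lc xc.
  have [a1l a3l a3a2] : [/\ a1 != l, a3 != l & a3 != a2].
    by rewrite (eq_sym a1) !(eq_sym a3) la1 la3.
  have cfy : c \in miss f y by rewrite (other_miss _ (foth c cl ca2)).
  have a1f t : (a1 \in miss f t) = (a1 \in miss g t) by exact: (other_miss _ (foth a1 a1l a12)).
  have a3f t : (a3 \in miss f t) = (a3 \in miss g t) by exact: (other_miss _ (foth a3 a3l a3a2)).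
  have fz : f y (zf u) = Some j by apply/eqP; rewrite (foth j jl (xj _ a2x)) gz.
  have fxu : f x u = Some j by apply/eqP; rewrite (foth j jl (xj _ a2x)) gxu.
  (* The color [a1] permits the move to [xu]. There [l] is missing at [x] while still on the edge to
     [wf u], and [a3], untouched so far, contradicts [fan]. *)
  have [||h [hV jh _ hoth _]] := step exy fV cfy (a := a1) _ zx _ fz fxu; rewrite ?a1f //.
  have hw : h u (wf u) = Some l by apply/eqP; rewrite hoth ?fw.
  have lhx : l \in miss h x by rewrite (other_miss _ (hoth l _ _ _)).
  have [a3c a3a1 a3j] : [/\ a3 != c, a3 != a1 & a3 != j].
    by rewrite xc // (eq_sym a3 a1) (eq_sym a3 j) xj.
  have a3h t : (a3 \in miss h t) = (a3 \in miss g t).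
    by rewrite (other_miss _ (hoth a3 a3c a3a1 a3j)).
  have exu := valid_edge gV gxu.
  by apply: (fan exu hV wx hw lhx (a := a3)); rewrite a3h.
have ends u : a2 \in miss g u -> end_vertex (kempe g l a2) u.
  by move=> au; apply: kempe_end gV _; rewrite au orbT.
have [_ wx gw _ /andP[a2w _]] := IP v vI; have [_ w'x gw' _ /andP[a2w' _]] := IP v' v'I.
have Ew : wf v = wf v'.
  apply: (three_ends (@kempe_deg2 _ _ _ _ l a2 gV) (kempe_sym _ _ gV) (ends x a2x)
    (ends _ a2w) (ends _ a2w') _ _ (link v vI) (link v' v'I)); by rewrite eq_sym.
rewrite (valid_sym gV) in gw; rewrite (valid_sym gV) -Ew in gw'.
by move: vv'; rewrite (valid_proper gV gw gw') eqxx.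
Qed.

Lemma bad_arith (i i1 i2 i3 i4 : nat) : 0 < N -> i4 <= 1 ->
  i <= 2 * N * (i1 + 2) -> i1 <= 16 * N ^ 2 * i2 -> i2 <= 2 * N * (i3 + 2) ->
  i3 <= 2 * N * (i4 + 2) -> i <= 516 * N ^ 5.
Proof.
move=> N0 h4 h h1 h2 h3.
have {}h3 : i3 <= 6 * N by apply: leq_trans h3 _; nia.
have {}h2 : i2 <= 16 * N ^ 2 by apply: leq_trans h2 _; nia.
have {}h1 : i1 <= 256 * N ^ 4.
  apply: leq_trans h1 _; rewrite (_ : 256 * N ^ 4 = 16 * N ^ 2 * (16 * N ^ 2)); last by nia.
  by rewrite leq_mul2l h2 orbT.
have N4 : 0 < N ^ 4 by rewrite expn_gt0 N0.
by apply: leq_trans h _; rewrite expnS; nia.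
Qed.

(** Four selections, each losing a bounded factor: a common [a1] missing at [x] and the [zf v]; a
    common color [l] on an edge from [v] to a low vertex [wf v]; common [a2], then [a3], missing at
    [x] and the [wf v]. By [two_sharing] at most one index survives them all. *)
Lemma card_bad y g c zf I : movable g y c zf I -> e x y -> low x -> 0 < #|C| ->
  (forall v, v \in I -> [/\ zf v != x, low (zf v) & #|C| < 8 * N ^ 2 * #|lows v|]) ->
  16 * N ^ 2 * (N + 3) <= #|C| -> #|I| <= 516 * N ^ 5.
Proof.
move=> gI exy xl C0 IP big.
have N0 : 0 < N by move: xl C0; rewrite /low; case: (N) => //; rewrite mul0n leqNgt => /negP.
have NC : 8 * N <= #|C| by apply: leq_trans big; nia.
have [I0|I0] := posnP #|I|; first by rewrite I0.
have zinj : {in I &, injective zf}.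
  case: gI => gV _ Ij v v' /Ij[j E1 E2] /Ij[j' E1' E2'] E; move: E1; rewrite E E1' => -[Ejj].
  by rewrite Ejj in E2'; apply: (valid_proper gV E2 E2').
have [|||g1 [a1 [I1 [gI1 I1I cI1 g1x [a1x a1P a1z _]]]]] :=
    enrich (f := zf) (Pr := [set c]) gI I0 zinj _ _ _ NC xl C0.
- by move=> v /IP[].
- by rewrite inE.
- by rewrite cards1.
have [/cards0_eq I10|I10] := posnP #|I1|.
  by move: cI1; rewrite I10 cards0 => cI1; apply: (@bad_arith _ 0 0 0 0).
case: (gI1) => g1V c1y I1j.
have a1x1 : a1 \in miss g1 x by rewrite (@eq_miss _ _ g) // => v; rewrite g1x.
pose P v := [set l | [&& l != c, l \notin miss g1 x &
    [exists w in lows v, (w != x) && (g1 v w == Some l)]]].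
(* Since [N + 3] is less than half of [#|lows v|], at least [#|C| / (16 * N ^ 2)] colors present at
   [x] lead from [v] to low vertices. *)
have [|l _ I1l] := @popular_element _ _ I1 set0 P (16 * N ^ 2) I10 C0.
  move=> v vI1; rewrite setD0; have [j gz gxv] := I1j v vI1.
  have [zx zl Lv] := IP v (subsetP I1I v vI1).
  have exv := valid_edge g1V gxv.
  have := colored_low_colors c exy g1V exv
    (card_low_colored_missing exy g1V c1y a1x1 zx (a1z v vI1) gz gxv xl NC C0).
  by move: Lv big; rewrite -/(P v); clear; nia.
set I2 := [set v in _ | _] in I1l.
pose wf v := odflt x [pick w in lows v | (w != x) && (g1 v w == Some l)].
have wfP v : v \in I2 -> [/\ wf v != x, low (wf v), g1 v (wf v) = Some l, l != c & l \notin miss g1 x].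
  rewrite inE => /andP[_]; rewrite inE => /and3P[lc lx /existsP[w wP]].
  rewrite /wf; case: pickP => [u /and3P[]|/(_ w)]; last by rewrite wP.
  by rewrite inE => /andP[_ ul] ux /eqP gu; split.
have [/cards0_eq I20|I20] := posnP #|I2|.
  by move: I1l; rewrite I20 cards0 => I1l; apply: (@bad_arith _ #|I1| 0 0 0).
have [v2 v2I2] := card_gt0P I20; have [_ _ _ lc lx] := wfP v2 v2I2.
have I2I1 : I2 \subset I1 by apply/subsetP => v; rewrite inE => /andP[].
have winj : {in I2 &, injective wf}.
  move=> v v' /wfP[_ _ E _ _] /wfP[_ _ E' _ _] Ew; rewrite -Ew in E'.
  rewrite (valid_sym g1V) in E; rewrite (valid_sym g1V) in E'.
  exact: (valid_proper g1V E E').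
have [|||g2 [a2 [I3 [gI3 I3I cI3 g2x [a2x a2P a2w oth2]]]]] :=
    enrich (f := wf) (Pr := [set c; l; a1]) (movable_sub I2I1 gI1) I20 winj _ _ _ NC xl C0.
- by move=> v /wfP[].
- by rewrite !inE eqxx.
- by rewrite -setUA !cardsU1 cards1; do 2!case: (_ \notin _).
have [/cards0_eq I30|I30] := posnP #|I3|.
  by move: cI3; rewrite I30 cards0 => cI3; apply: (@bad_arith _ #|I1| #|I2| 0 0).
have winj3 : {in I3 &, injective wf}.
  by move=> v v' vI v'I; apply: winj; apply: (subsetP I3I).
have [|||g3 [a3 [I4 [gI4 I4I cI4 g3x [a3x a3P a3w oth3]]]]] :=
    enrich (f := wf) (Pr := [set c; l; a1; a2]) gI3 I30 winj3 _ _ _ NC xl C0.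
- by move=> v /(subsetP I3I)/wfP[].
- by rewrite !inE eqxx.
- by rewrite -!setUA !cardsU1 cards1; do 3!case: (_ \notin _).
apply: (@bad_arith #|I| #|I1| #|I2| #|I3| #|I4|) => //.
rewrite leqNgt; apply/negP => /card_gt1P[v [v' [vI v'I vv']]].
have missx2 b : (b \in miss g2 x) = (b \in miss g1 x).
  by rewrite (@eq_miss _ _ g1) // => u; rewrite g2x.
have missx3 b : (b \in miss g3 x) = (b \in miss g1 x).
  by rewrite -missx2 (@eq_miss _ _ g2) // => u; rewrite g3x.
move: a2P; rewrite !inE !negb_or => /andP[/andP[a2c a2l] a2a1].
move: a3P; rewrite !inE !negb_or => /andP[/andP[/andP[a3c a3l] a3a1] a3a2].
apply: (two_sharing exy gI4 vI v'I vv' lc (l := l) (wf := wf) (a1 := a1) (a2 := a2) (a3 := a3)).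
- by rewrite missx3.
- by rewrite /= !inE negb_or ![a1 == _]eq_sym a2a1 a3a1 (eq_sym a2) a3a2.
- by rewrite missx3.
- by rewrite missx3.
- by rewrite missx3 -missx2.
move=> u uI; have uI3 := subsetP I4I u uI; have uI2 := subsetP I3I u uI3.
have uI1 := subsetP I2I1 u uI2.
have [wx _ gw _ _] := wfP u uI2; have [zx _ _] := IP u (subsetP I1I u uI1).
have a1in3 : a1 \in [set c; l; a1; a2] by rewrite !inE eqxx !orbT.
have a1in2 : a1 \in [set c; l; a1] by rewrite !inE eqxx !orbT.
have a2in3 : a2 \in [set c; l; a1; a2] by rewrite !inE eqxx !orbT.
have lin3 : l \in [set c; l; a1; a2] by rewrite !inE eqxx !orbT.
have lin2 : l \in [set c; l; a1] by rewrite !inE eqxx !orbT.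
split=> //.
- by apply/eqP; rewrite oth3 // oth2 // gw.
- by rewrite (other_miss _ (oth3 a1 a1in3)) (other_miss _ (oth2 a1 a1in2)) a1z.
- by rewrite (other_miss _ (oth3 a2 a2in3)) a2w // a3w.
Qed.

(** Apart from [x] and at most [N] fan neighbors, each low neighbor of [y] is joined by the color of
    some [xv], which makes [v] movable; distinct neighbors give distinct [v]. At most [516 * N ^ 5]
    of these [v] have many low neighbors. Multiplied by [4 * N] this is [2064 * N ^ 6], less than
    half of [#|C|], so enough good [v] are left. *)
Lemma few_lows_nbrs y : e x y -> low x -> 0 < #|C| -> 4900 * N ^ 6 <= #|C| ->
  60 <= N -> #|C| < 4 * N * #|lows y| ->
  #|C| <= 8 * N * #|[set v | e x v && (8 * N ^ 2 * #|lows v| <= #|C|)]|.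
Proof.
move=> exy xl C0 big N60 Ly; have [g gV] := e_crit exy.
have [c cy] := miss_root_gt0 exy gV.
have N0 : 0 < N by apply: leq_trans N60.
have N6 : N ^ 6 = N ^ 3 * N ^ 3 by rewrite -expnD.
have N3 : 0 < N ^ 3 by rewrite expn_gt0 N0.
have big2 : 16 * N ^ 2 * (N + 3) <= #|C|.
  have N23 : N ^ 2 <= N ^ 3 by apply: leq_pexp2l.
  have N36 : N ^ 3 <= N ^ 3 * N ^ 3 by rewrite leq_pmulr.
  have E : 16 * N ^ 2 * (N + 3) = 16 * N ^ 3 + 48 * N ^ 2.
    by rewrite mulnDr -mulnA -expnSr -[in X in _ + X]mulnA (mulnC (N ^ 2) 3) mulnA.
  by move: big N23 N36; rewrite E N6; move: (N ^ 2) (N ^ 3) (N ^ 3 * N ^ 3); clear; lia.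
have NC : 8 * N <= #|C| by apply: leq_trans big2; nia.
pose zP v z := [&& z != x, low z & isSome (g x v) && (g y z == g x v)].
pose J := [set v | [exists z, zP v z]].
pose zf v := odflt x [pick z | zP v z].
have zfP v : v \in J -> [/\ zf v != x, low (zf v) & exists2 j, g y (zf v) = Some j & g x v = Some j].
  rewrite inE => /existsP[z0 z0P]; rewrite /zf; case: pickP => [z|/(_ z0)]; last by rewrite z0P.
  move=> /and3P[zx zl /andP[]]; case E: (g x v) => [j|] //= _ /eqP gz.
  by split=> //; exists j.
pose B := [set v in J | #|C| < 8 * N ^ 2 * #|lows v|].
have cB : #|B| <= 516 * N ^ 5.
  apply: (@card_bad y g c zf) => //.
    by split=> // v; rewrite inE => /andP[/zfP[]].
  by move=> v; rewrite inE => /andP[/zfP[]].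
set G := [set v | _ & _].
have cG : #|J :\: B| <= #|G|.
  apply: subset_leq_card; apply/subsetP => v; rewrite in_setD => /andP[vB vJ].
  have [_ _ [j _ gxv]] := zfP v vJ.
  by rewrite inE (valid_edge gV gxv) /=; move: vB; rewrite inE vJ -leqNgt.
have cJ : #|J :&: B| + #|J :\: B| = #|J| := cardsID _ _.
have cJB : #|J :&: B| <= #|B| := subset_leq_card (subsetIr _ _).
have M2 : 2 < #|miss g x|.
  by have := low_card_miss gV xl; move: NC C0; clear; nia.
pose S := lows y :&: fan_nbrs g y.
have cS : #|S| <= N.
  apply: (card_low_fan exy gV M2 C0) => w; rewrite in_setI => /andP[+ wF].
  by rewrite inE => /andP[].
have cQ : #|lows y :\: fan_nbrs g y :\ x| <= #|J|.
  pose u w := odflt x [pick v | isSome (g y w) && (g x v == g y w)].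
  have uP w : w \in lows y :\: fan_nbrs g y :\ x ->
      [/\ w != x, low w & exists2 j, g y w = Some j & g x (u w) = Some j].
    rewrite !in_setD in_set1 => /and3P[wx wF]; rewrite inE => /andP[eyw wl].
    have [|j E] := valid_some gV eyw.
      apply/negP => /orP[]/andP[/eqP E1 /eqP E2]; last by rewrite E2 eqxx in wx.
      by rewrite E1 e_irr in exy.
    split=> //; exists j => //; rewrite /u E; case: pickP => [v /andP[_ /eqP]//|/= none].
    case/negP: wF; apply/fan_nbrsP; split=> //; exists j => //.
    by apply/missP => v gxv; have := none v; rewrite gxv eqxx.
  rewrite -(@card_in_imset _ _ u); last first.
    move=> w w' /uP[_ _ [j E E1]] /uP[_ _ [j' E' E1']] Eu; move: E1; rewrite Eu E1' => -[Ej].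
    by rewrite Ej in E'; apply: (valid_proper gV E E').
  apply: subset_leq_card; apply/subsetP => v /imsetP[w /uP[wx wl [j E E1]] ->].
  by rewrite inE; apply/existsP; exists w; rewrite /zP wx wl E1 E eqxx.
have E1 : #|lows y :&: fan_nbrs g y| + #|lows y :\: fan_nbrs g y| = #|lows y| := cardsID _ _.
have E2 : #|lows y :\: fan_nbrs g y| <= 1 + #|lows y :\: fan_nbrs g y :\ x|.
  by rewrite (cardsD1 x (lows y :\: _)) leq_add2r leq_b1.
have Lb : #|lows y| <= N + 1 + 516 * N ^ 5 + #|G|.
  by move: cS cQ cG cJ cJB cB E1 E2; rewrite /S; clear; lia.
have N65 : N ^ 6 = N * N ^ 5 by rewrite expnS.
have N5 : N ^ 5 = N * N ^ 4 by rewrite expnS.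
have N4 : 0 < N ^ 4 by rewrite expn_gt0 N0.
have {}Ly : #|C| < 4 * N * (N + 1) + 2064 * N ^ 6 + 4 * N * #|G|.
  by apply: leq_trans Ly _; apply: leq_trans (leq_mul (leqnn (4 * N)) Lb) _; nia.
have NN : 8 * N * (N + 1) <= 16 * N ^ 6.
  have N26 : N ^ 2 <= N ^ 6 by apply: leq_pexp2l.
  apply: leq_trans (_ : 16 * N ^ 2 <= _); last by rewrite leq_mul2l N26.
  by rewrite -mulnn; move: N0; clear; nia.
by move: Ly NN big; clear; lia.
Qed.

End Rough.

End Paths.

End Critical.

(** * Colorings of the edge set versus symmetric functions on pairs *)

Section EdgeColorings.
Variables (T : finType) (e : rel T).
Hypothesis e_sym : symmetric e.
Hypothesis e_irr : irreflexive e.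

Lemma eq_set2 (u v s t : T) : ([set s; t] == [set u; v]) = same_edge u v s t.
Proof.
apply/eqP/idP => [E|/orP[]/andP[/eqP-> /eqP->] //]; last by rewrite setUC.
have sE : s \in [set u; v] by rewrite -E set21.
have tE : t \in [set u; v] by rewrite -E set22.
have uE : u \in [set s; t] by rewrite E set21.
have vE : v \in [set s; t] by rewrite E set22.
rewrite /same_edge; move: sE tE uE vE => /set2P[]-> /set2P[]->; rewrite ?eqxx ?orbT //.
  by move=> _ /set2P[]->; rewrite eqxx.
by move=> /set2P[]->; rewrite eqxx.
Qed.

Lemma mem_edges (u v : T) : ([set u; v] \in edges e) = e u v.
Proof.
apply/imsetP/idP => [[[s t]]|euv]; last by exists (u, v).
rewrite inE /= => est /eqP; rewrite eq_set2 => /orP[]/andP[/eqP-> /eqP->] //.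
by rewrite e_sym.
Qed.

Lemma partial_coloring_edge_colorable k (g : T -> T -> option 'I_k) : 0 < k -> partial_coloring e g -> edge_colorable e k.
Proof.
move=> k0 [gS gP gD]; pose c0 := Ordinal k0.
pose col (A : edge_type e) : 'I_k := odflt c0
  (obind (fun p : T * T => g p.1 p.2) [pick p : T * T | e p.1 p.2 && (val A == [set p.1; p.2])]).
have colE (A : edge_type e) u v : val A = [set u; v] -> Some (col A) = g u v.
  move=> EA; have euv : e u v by rewrite -mem_edges -EA (valP A).
  rewrite /col; case: pickP => [[s t] /= /andP[est]|/(_ (u, v))]; last first.
    by rewrite /= euv EA eqxx.
  rewrite EA eq_sym eq_set2 => st; have := gD u v; rewrite euv.
  have -> : g s t = g u v by move: st => /orP[]/andP[/eqP-> /eqP->].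
  by case: (g u v).
apply/existsP; exists [ffun A => col A]; apply/forallP => A; apply/forallP => B.
apply/implyP => /andP[AB /set0Pn[u]]; rewrite inE => /andP[uA uB]; rewrite !ffunE.
have edgeE (A' : edge_type e) : u \in val A' -> exists v, val A' = [set u; v].
  have /imsetP[[s t] _ /= ->] := valP A'; rewrite !inE => /orP[]/eqP->; first by exists t.
  by exists s; rewrite setUC.
have [v EA] := edgeE A uA; have [w EB] := edgeE B uB.
apply: contra AB => /eqP Ec; have E1 := colE A u v EA; have E2 := colE B u w EB.
have Evw : v = w by apply: (gP u v w (col B)); rewrite -?E2 // -E1 Ec.
by rewrite -val_eqE EA EB Evw.
Qed.

Lemma edge_colorable_partial_coloring k u v : edge_colorable (delete_edge e [set u; v]) k ->
  exists g : T -> T -> option 'I_k, partial_coloring (minus_edge e u v) g.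
Proof.
move=> /existsP[c cP]; set e' := delete_edge e _ in c cP.
have e'E s t : e' s t = minus_edge e u v s t by rewrite /e' /delete_edge /= eq_set2.
have e'S : symmetric e' by move=> s t; rewrite !e'E /minus_edge /= e_sym same_edgeC.
have memE s t : ([set s; t] \in edges e') = e' s t.
  apply/imsetP/idP => [[[s' t']]|est]; last by exists (s, t).
  by rewrite inE [(_, _).1]/= [(_, _).2]/= => est' /eqP; rewrite eq_set2 =>
    /orP[]/andP[/eqP-> /eqP->] //; rewrite e'S.
exists (fun s t => omap c (insub [set s; t])); split.
- by move=> s t; rewrite setUC.
- move=> s t t' a; case: insubP => [A _ EA|] //= [Ea]; case: insubP => [B _ EB|] //= [Eb].
  apply/eqP/negPn/negP => tt'; move/forallP/(_ A)/forallP/(_ B): cP.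
  rewrite Ea Eb eqxx implybF negb_and -val_eqE /= EA EB negbK => /orP[].
    rewrite eq_set2 /same_edge => /orP[]/andP[/eqP E1 /eqP E2].
      by rewrite E2 eqxx in tt'.
    by rewrite E2 -E1 eqxx in tt'.
  by rewrite negbK => /eqP/setP/(_ s); rewrite !inE eqxx.
by move=> s t; rewrite -e'E -memE; case: insubP => [A ->|/negPf->].
Qed.

Lemma critical_uncolorable : 0 < max_degree e -> Delta_critical e ->
  forall g : T -> T -> option 'I_(max_degree e), ~ partial_coloring e g.
Proof.
move=> D0 [_ chi _] g /(partial_coloring_edge_colorable D0) ecD; move: chi.
by rewrite /chromatic_index; case: ex_minnP => m _ /(_ _ ecD) mD E; rewrite E ltnn in mD.
Qed.

Lemma critical_minus_edge : Delta_critical e ->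
  forall u v, e u v -> exists g : T -> T -> option 'I_(max_degree e), partial_coloring (minus_edge e u v) g.
Proof.
move=> [_ _ crit] u v euv; apply: edge_colorable_partial_coloring.
have := crit [set u; v]; rewrite mem_edges => /(_ euv).
by rewrite /chromatic_index; case: ex_minnP => m mC _ <-.
Qed.

Lemma degree_le_max u : degree e u <= #|'I_(max_degree e)|.
Proof. by rewrite card_ord; apply: (@leq_bigmax _ (degree e)). Qed.

End EdgeColorings.

(** * Low degree vertices around a vertex of a critical graph *)

Section CriticalGraphs.
Variables (T : finType) (e : rel T).
Hypothesis e_sym : symmetric e.
Hypothesis e_irr : irreflexive e.
Hypothesis e_crit : Delta_critical e.
Hypothesis D_gt0 : 0 < max_degree e.
Notation D := (max_degree e).

Lemma critical_closure x y lo mi : e x y -> degree e x + lo + mi + 2 <= D -> lo <= mi ->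
  exists R : {set T}, [/\ y \in R, {in R, forall v, e x v}
   & \sum_(v in R) #|low_nbrs e x lo v| + 2 +
     [exists v in R, [exists w, [&& e v w, w != x & lo < degree e w <= mi]]] <= #|R|].
Proof.
move=> exy; have := @closure_bound T 'I_D e e_sym e_irr (critical_uncolorable e_sym D_gt0 e_crit)
  (@degree_le_max _ _) (critical_minus_edge e_sym e_crit) x lo mi y exy.
by rewrite card_ord; apply.
Qed.

Lemma critical_deficient x y : e x y -> degree e x + 2 < D ->
  #|[set w | e y w && (degree e w < D)]| <= 2 * degree e x.
Proof.
move=> exy; have := @card_deficient_nbrs T 'I_D e e_sym e_irr
  (critical_uncolorable e_sym D_gt0 e_crit)
  (@degree_le_max _ _) (critical_minus_edge e_sym e_crit) x y exy.
by rewrite card_ord; apply.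
Qed.

Lemma critical_few_lows N x y : e x y -> low e D N x ->
  4900 * N ^ 6 <= D -> 60 <= N -> D < 4 * N * #|lows e D N y| ->
  D <= 8 * N * #|[set v | e x v && (8 * N ^ 2 * #|lows e D N v| <= D)]|.
Proof.
move=> exy xl big N60 Ly; have := @few_lows_nbrs T 'I_D e e_sym e_irr (critical_uncolorable e_sym D_gt0 e_crit)
  (@degree_le_max _ _) (critical_minus_edge e_sym e_crit) x N y exy.
by rewrite card_ord; apply=> //.
Qed.

Lemma sum_in_ge (R : {set T}) (f : T -> nat) y : y \in R -> 0 < f y ->
  f y + #|[set v in R | 0 < f v]| <= 1 + \sum_(v in R) f v.
Proof.
move=> yR fy; rewrite (bigD1 y) //= (cardsD1 y) inE yR fy /= addnCA leq_add2l leq_add2l.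
rewrite -sum1_card big_mkcond [leqRHS]big_mkcond; apply: leq_sum => v _.
by rewrite !inE; case: (v == y); case: (v \in R); case: (f v).
Qed.

(** The sum over [R] spends 1 on each vertex with a positive value, and [f y - 1] more at [y] if
    [f y] is positive. The surplus 2 then forces at least [f y + 1] vertices of value 0. *)
Lemma ones_count x y lo : e x y -> degree e x + lo + lo + 2 <= D ->
  let m := #|[set v | e x v && (#|low_nbrs e x lo v| == 0)]| in
  (2 <= m) && (#|low_nbrs e x lo y| < m).
Proof.
move=> exy klo /=; set f := fun v => #|low_nbrs e x lo v|; set O := [set v | _].
have [R [yR RN]] := critical_closure exy klo (leqnn lo).
rewrite -/f => HR; have {}HR : \sum_(v in R) f v + 2 <= #|R|.
  by apply: leq_trans HR; rewrite leq_addr.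
have E : #|R| = #|[set v in R | 0 < f v]| + #|[set v in R | f v == 0]|.
  have <- : R :&: [set v | 0 < f v] = [set v in R | 0 < f v].
    by apply/setP => v; rewrite !inE.
  have <- : R :\: [set v | 0 < f v] = [set v in R | f v == 0].
    by apply/setP => v; rewrite !inE; case: (v \in R); case: (f v).
  by rewrite cardsID.
have ER : #|[set v in R | f v == 0]| <= #|O|.
  apply: subset_leq_card; apply/subsetP => v; rewrite !inE => /andP[vR ->].
  by rewrite (RN v vR).
have [fy|fy] := posnP (f y).
  have c : #|[set v in R | 0 < f v]| <= \sum_(v in R) f v.
    rewrite -sum1_card big_mkcond [leqRHS]big_mkcond; apply: leq_sum => v _.
    by rewrite inE; case: (v \in R); case: (f v).
  have : 1 < #|O| by move: HR E ER c; clear; lia.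
  by rewrite -/(f y) fy => O2; rewrite O2 ltnW.
have := sum_in_ge yR fy; rewrite -/(f y).
by move: HR E ER fy; clear; lia.
Qed.

Definition no_mid x lo mi :=
  forall v w, e x v -> e v w -> w != x -> ~~ (lo < degree e w <= mi).

(** The sets [R] of the closure bound have at most four elements. If [P] is nonempty in degree 3, or
    has two elements in degree 4, the bound is an equality on sets [R] that together contain all
    neighbors of [x], leaving no room for its extra term: hence [no_mid]. *)
Lemma critical_tight x lo mi : 2 < degree e x <= 4 -> degree e x + lo + mi + 2 <= D -> lo <= mi ->
  let a v := #|low_nbrs e x lo v| in
  let P := [set v | e x v && (0 < a v)] in
  [/\ #|P| <= 1, degree e x = 3 -> P = set0 & forall v, e x v -> a v <= 2] \/
  [/\ #|P| <= degree e x - 2, forall v, e x v -> a v <= 1 & no_mid x lo mi].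
Proof.
move=> k34 klm lm a P; set k := degree e x in k34 klm *.
pose mid (R : {set T}) := [exists v in R, [exists w, [&& e v w, w != x & lo < degree e w <= mi]]].
have cl y : e x y -> exists R : {set T}, [/\ y \in R, {in R, forall v, e x v}, #|R| <= k
   & \sum_(v in R) a v + 2 + mid R <= #|R|].
  move=> exy; have [R [yR RN HR]] := critical_closure exy klm lm.
  exists R; split=> //; apply: subset_leq_card; apply/subsetP => v /RN.
  by rewrite inE.
have full (R : {set T}) : {in R, forall v, e x v} -> k <= #|R| -> forall v, e x v -> v \in R.
  move=> RN kR v exv; have -> : R = [set v | e x v]; last by rewrite inE.
  apply/eqP; rewrite eqEcard [#|[set _ | _]|]/(degree e x) kR andbT.
  by apply/subsetP => u /RN; rewrite inE.
have sum1 (R : {set T}) v : v \in R -> a v <= \sum_(u in R) a u.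
  by move=> vR; rewrite (bigD1 v) //= leq_addr.
have sum2 (R : {set T}) v u : v \in R -> u \in R -> v != u -> a v + a u <= \sum_(t in R) a t.
  move=> vR uR vu; rewrite (bigD1 v) //= (bigD1 u) /=; last by rewrite uR eq_sym.
  by rewrite addnA leq_addr.
have midP (R : {set T}) : mid R = false -> forall v w, v \in R -> e v w -> w != x ->
    ~~ (lo < degree e w <= mi).
  move=> mR v w vR evw wx; apply/negP => h; move/negbT/negP: mR; apply; rewrite /mid.
  apply/existsP; exists v.
  by rewrite vR; apply/existsP; exists w; rewrite evw wx h.
have mid01 R : mid R <= 1 by case: (mid R).
have [y /andP[exy ay]|none] := pickP [pred v | e x v && (0 < a v)]; last first.
  have P0 : P = set0 by apply/setP => v; rewrite !inE; apply: none.
  left; rewrite P0 cards0; split=> // v exv.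
  by have := none v; rewrite /= exv /= lt0n => /negbFE/eqP->.
have Psum (R : {set T}) : #|P :&: R| <= \sum_(v in R) a v.
  rewrite -sum1_card big_mkcond [leqRHS]big_mkcond; apply: leq_sum => v _.
  by rewrite !inE; case: (v \in R); rewrite ?andbF ?andbT //; case: (e x v); case: (a v).
have allR (R : {set T}) : {in R, forall v, e x v} -> k <= #|R| -> P :&: R = P.
  by move=> RN kR; apply/setIidPl/subsetP => v; rewrite inE => /andP[exv _]; apply: full exv.
have [k3|k4] : k = 3 \/ k = 4.
  by case/andP: k34; clear; case: (k) => [|[|[|[|[|?]]]]] //; [left | right].
  have [R [yR RN Rk HR]] := cl y exy; right.
  have aS := sum1 R y yR.
  have [S1 kR mR] : [/\ \sum_(v in R) a v <= 1, k <= #|R| & mid R = 0 :> nat].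
    by move: HR Rk aS ay k3; clear => *; split; lia.
  have {}mR : mid R = false by case: (mid R) mR.
  split.
  - by rewrite -(allR R RN kR) k3; apply: leq_trans (Psum R) S1.
  - by move=> v exv; apply: leq_trans (sum1 R v (full R RN kR v exv)) S1.
  - by move=> v w exv; apply: midP mR _ _ (full R RN kR v exv).
have [P1|/card_gt1P[y1 [y2 [y1P y2P y12]]]] := leqP #|P| 1.
  left; split=> [//||v exv]; first by rewrite k4.
  have [R [vR RN Rk HR]] := cl v exv; have := sum1 R v vR.
  by move: HR Rk k4; clear; lia.
move: y1P y2P; rewrite !inE => /andP[exy1 a1] /andP[exy2 a2].
right; rewrite k4.
have big (R : {set T}) : {in R, forall v, e x v} -> y1 \in R -> k <= #|R| -> #|R| <= k ->
    \sum_(v in R) a v + 2 + mid R <= #|R| ->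
    [/\ #|P| <= 4 - 2, forall v, e x v -> a v <= 1 & no_mid x lo mi].
  move=> RN y1R kR Rk HR; have fR := full R RN kR.
  have S12 := sum2 R y1 y2 y1R (fR y2 exy2) y12.
  have [S2 mR] : \sum_(v in R) a v <= 2 /\ mid R = 0 :> nat.
    by move: HR Rk S12 a1 a2 k4; clear; lia.
  have {}mR : mid R = false by case: (mid R) mR.
  split.
  - by rewrite -(allR R RN kR); apply: leq_trans (Psum R) S2.
  - move=> v exv; have [->|vy1] := eqVneq v y1; first by move: S12 S2 a2; clear; lia.
    by have := sum2 R v y1 (fR v exv) y1R vy1; move: S2 a1; clear; lia.
  - by move=> v w exv; apply: midP mR _ _ (fR v exv).
have [R1 [y1R1 R1N R1k HR1]] := cl y1 exy1.
have [R2 [y2R2 R2N R2k HR2]] := cl y2 exy2.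
have [kR1|R1lt] := leqP k #|R1|; first exact: big R1N y1R1 kR1 R1k HR1.
have [kR2|R2lt] := leqP k #|R2|.
  exact: big R2N (full R2 R2N kR2 y1 exy1) kR2 R2k HR2.
have s1 := sum1 R1 y1 y1R1; have s2 := sum1 R2 y2 y2R2.
(* Neither set is the whole neighborhood, so both have three elements and sum 1. Then [y2] is
   outside [R1], and the two exhaust the neighbors of [x]. *)
have [S1 mR1 cR1] : [/\ \sum_(v in R1) a v <= 1, mid R1 = 0 :> nat & #|R1| = 3].
  by move: HR1 R1lt s1 a1 k4; clear => *; split; lia.
have [S2 mR2] : \sum_(v in R2) a v <= 1 /\ mid R2 = 0 :> nat.
  by move: HR2 R2lt s2 a2 k4; clear; lia.
have {}mR1 : mid R1 = false by case: (mid R1) mR1.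
have {}mR2 : mid R2 = false by case: (mid R2) mR2.
have y2R1 : y2 \notin R1.
  by apply/negP => y2R1; have := sum2 R1 y1 y2 y1R1 y2R1 y12; move: S1 a1 a2; clear; lia.
have cover v : e x v -> v = y2 \/ v \in R1.
  move=> exv; have : v \in y2 |: R1.
    apply: full exv => [u|]; first by rewrite !inE => /predU1P[->//|/R1N].
    by rewrite cardsU1 y2R1 cR1 k4.
  by rewrite !inE => /predU1P.
split.
- have Psub : P \subset y2 |: (P :&: R1).
    apply/subsetP => v vP; have exv : e x v by move: vP; rewrite inE => /andP[].
    by rewrite in_setU1 in_setI vP; case: (cover v exv) => ->; rewrite ?eqxx ?orbT.
  apply: leq_trans (subset_leq_card Psub) _; rewrite cardsU1.
  by have := Psum R1; move: S1; case: (_ \notin _) => /=; clear; lia.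
- by move=> v /cover[->|vR1]; [apply: leq_trans s2 S2 | apply: leq_trans (sum1 R1 v vR1) S1].
- by move=> v w /cover[->|vR1]; [apply: midP mR2 _ _ y2R2 | apply: midP mR1 _ _ vR1].
Qed.

End CriticalGraphs.

(** * Discharging *)

Import Order.TTheory GRing.Theory Num.Theory.
Local Open Scope ring_scope.

(** * The double counting behind discharging *)

Section Weights.
Variables (R : realFieldType) (T : finType) (e : rel T).
Hypothesis e_sym : symmetric e.

(** All charge received by [X] comes from outside [X]. Strictness has two sources: a vertex of [X]
    in [A] receives more than 1; if there is none, vertices outside [X] send to [X] only charge that
    stays strictly below [c]. *)
Lemma weight_bound (weight : T -> T -> R) (A : pred T) (X : {set T}) (c : R) : 0 <= c ->
  independent e X -> (exists y, y \notin X) ->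
  (forall y z, e y z -> 0 <= weight y z) ->
  (forall y, \sum_(z | e y z) weight y z <= c) ->
  (forall y, \sum_(z | e y z && ~~ A z) weight y z < c) ->
  (forall x, 1 <= \sum_(y | e x y) weight y x) ->
  (forall x, A x -> 1 < \sum_(y | e x y) weight y x) ->
  #|X|%:R < c * #|~: X|%:R.
Proof.
move=> c0 indX [y0 y0X] wt0 wtc wtcA wt1 wt1A.
have nX x y : x \in X -> e x y -> y \notin X.
  move=> xX exy; apply/negP => yX.
  by move/forall_inP/(_ x xX)/forall_inP/(_ y yX): indX; rewrite exy.
have swap : \sum_(x in X) \sum_(y | e x y) weight y x =
    \sum_(y in ~: X) \sum_(z | e y z && (z \in X)) weight y z.
  rewrite (exchange_big_dep (mem (~: X))) /=; last first.
    by move=> x y xX exy; rewrite inE (nX x).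
  apply: eq_bigr => y _; apply: eq_bigl => z; by rewrite e_sym andbC.
have cardE (S : {set T}) : #|S|%:R = \sum_(x in S) (1 : R) by rewrite sumr_const.
have le1 : #|X|%:R <= \sum_(x in X) \sum_(y | e x y) weight y x.
  by rewrite cardE; apply: ler_sum => x _.
have le2 : \sum_(y in ~: X) \sum_(z | e y z && (z \in X)) weight y z <= c * #|~: X|%:R.
  rewrite cardE big_distrr /=; apply: ler_sum => y _; rewrite mulr1.
  apply: le_trans (wtc y); rewrite [leRHS](bigID (mem X)) /= lerDl.
  by apply: sumr_ge0 => z /andP[eyz _]; apply: wt0.
have [x0 /andP[x0X x0A]|none] := pickP [pred x | (x \in X) && A x].
  apply: lt_le_trans le2; rewrite -swap cardE [ltLHS](bigD1 x0) //= [ltRHS](bigD1 x0) //=.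
  by apply: ltr_leD; [exact: wt1A | apply: ler_sum => x _].
apply: le_lt_trans le1 _; rewrite swap cardE big_distrr /=.
have key y : \sum_(z | e y z && (z \in X)) weight y z < c * 1.
  rewrite mulr1; apply: le_lt_trans (wtcA y).
  rewrite [leRHS](bigID (mem X)) /= -[leLHS]addr0; apply: lerD.
    rewrite (eq_bigl [pred z | e y z && ~~ A z && (z \in X)]) // => z /=.
    by have := none z => /=; case: (z \in X); rewrite ?andbF //= ?andbT => ->; rewrite andbT.
  by apply: sumr_ge0 => z /andP[/andP[eyz _] _]; apply: wt0.
have y0C : y0 \in ~: X by rewrite inE.
rewrite [ltLHS](bigD1 y0) //= [ltRHS](bigD1 y0) //=; apply: ltr_leD; first exact: key.
by apply: ler_sum => y _; apply/ltW/key.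
Qed.

End Weights.

(** * Numerical estimates for degrees 3 and 4 *)

Section Arithmetic.
Variable R : realFieldType.
Implicit Types a d p x : R.

(** With [x] the maximum degree: [2 / (d + 2)] times [d / 2 + 1] is exactly 1, and the base charge
    [d / x] exceeds the loss [(d / 2 + 1) / x]. *)
Lemma tight_value d x : 3 <= d -> 0 < x -> 1 < d / x + (2 / (d + 2) - x^-1) * (d / 2 + 1).
Proof.
move=> d3 x0; have -> : d / x + (2 / (d + 2) - x^-1) * (d / 2 + 1) = 1 + (d / 2 - 1) / x.
  by field; rewrite !gt_eqF //; clear -d3; lra.
by rewrite ltrDl divr_gt0 //; lra.
Qed.

Lemma tight_share d : 0 <= d <= 4 -> 4900^-1 <= 2 / (d + 2).
Proof. by move=> /andP[d0 d4]; rewrite ler_pdivlMr; lra. Qed.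

Lemma half_count p d : p <= d - 2 -> d / 2 + 1 <= p * 2^-1 + (d - p) * 1.
Proof. by move=> pd; lra. Qed.

Lemma shifted_inv_le a x : 0 <= a <= 2 -> 0 <= x -> (3 + x)^-1 <= (1 + a + x)^-1.
Proof. by move=> /andP[a0 a2] x0; rewrite lef_pV2 ?posrE; lra. Qed.

Lemma inv_ge (u v : R) : 0 < u -> u * v <= 1 -> v <= u^-1.
Proof. by move=> u0 uv; rewrite -div1r ler_pdivlMr // mulrC. Qed.

(** Here [2 / 59], like [2 / 71] for degree 4, is [2 / (N - 1)]; the product of [d] and [d / 2000]
    accounts for tiny vertices of degree above 2000. *)
Lemma slack3 : 1 <= (2 / 5 - 2 / 59) * (3 * (1 + 3 * (3 / 2000))^-1) :> R.
Proof.
have : 198 / 200 <= (1 + 3 * (3 / 2000) : R)^-1 by apply: inv_ge; lra.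
by set u := (1 + _)^-1 => u1; lra.
Qed.

Lemma slack4 p : 0 <= p <= 1 -> 1 <= (2 / 6 - 2 / 71) *
  (p * (3 + 4 * (4 / 2000))^-1 + (4 - p) * (1 + 4 * (4 / 2000))^-1).
Proof.
move=> /andP[p0 p1].
have : 992 / 1000 <= (1 + 4 * (4 / 2000) : R)^-1 by apply: inv_ge; lra.
have : 332 / 1000 <= (3 + 4 * (4 / 2000) : R)^-1 by apply: inv_ge; lra.
have : (3 + 4 * (4 / 2000) : R)^-1 <= (1 + 4 * (4 / 2000) : R)^-1 by rewrite lef_pV2 ?posrE; lra.
set u := (3 + _)^-1; set v := (1 + _)^-1 => uv u1 v1.
have : 3 * v + u <= p * u + (4 - p) * v by nra.
by lra.
Qed.

End Arithmetic.

(** * The weights: what a vertex sends and receives *)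

Section Discharging.
Variables (R : realFieldType) (T : finType) (e : rel T).
Hypothesis e_sym : symmetric e.
Hypothesis e_irr : irreflexive e.
Hypothesis e_crit : Delta_critical e.
Notation D := (max_degree e).
Variables (N d : nat) (eps : R).
Hypothesis N_ge60 : (60 <= N)%N.
Hypothesis D_big : (4900 * N ^ 6 <= D)%N.
Hypothesis d_ge3 : (3 <= d)%N.
Hypothesis deg_ge : forall z, (d <= degree e z)%N.

Notation dg z := ((degree e z)%:R : R).
Notation Dr := (D%:R : R).
Notation Nr := (N%:R : R).

Definition tiny z := (4 * degree e z <= D)%N.
Notation lowz := (low e D N).
Notation lowsz := (lows e D N).

(** The rate decreases as low neighbors become more numerous, so that the total paid at this rate
    never exceeds [1 / N]. *)
Definition pay y : R :=
  if (8 * N ^ 2 * #|lowsz y| <= D)%N then 8 * Nr / Dr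
  else if (4 * N * #|lowsz y| <= D)%N then 4 / Dr else 0.

Definition cost y : R :=
  pay y * #|[set z | [&& e y z, lowz z & ~~ tiny z]]|%:R +
  \sum_(z | e y z && ~~ lowz z) ((dg z)^-1 - Dr^-1).

Definition inv_sum y : R := \sum_(z | e y z && tiny z) (dg z)^-1.

(* What [y] sends to [z]. A vertex of degree [k] that is not low gets exactly
   [1 / k] from each neighbor; what remains of the budget [1 + eps] after the
   vertices that are not tiny is shared by the tiny ones in proportion to
   [1 / degree]. *)
Definition weight y z : R := Dr^-1 +
  (if tiny z then (eps - cost y) / (dg z * inv_sum y)
   else if lowz z then pay y else (dg z)^-1 - Dr^-1).

(** It bounds [cost]: at most [1 / N] for low vertices and [1 / (N - 1)] for the others. *)
Let delta : R := 2 / (Nr - 1).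

Hypothesis delta_eps : delta < eps.

Lemma N_ge60R : 60 <= Nr.
Proof. by rewrite ler_nat. Qed.

Lemma D_gt0 : (0 < D)%N.
Proof. by apply: leq_trans D_big; rewrite muln_gt0 expn_gt0; apply/orP; left; apply: leq_trans N_ge60. Qed.

Lemma Dr_gt0 : 0 < Dr.
Proof. by rewrite ltr0n D_gt0. Qed.

Lemma deg_gt0 z : 0 < dg z.
Proof. by rewrite ltr0n; apply: leq_trans (deg_ge z); apply: leq_trans d_ge3. Qed.

Lemma deg_leD z : (degree e z <= D)%N.
Proof. by rewrite -[D]card_ord; apply: degree_le_max. Qed.

Lemma tiny_low z : tiny z -> lowz z.
Proof. by rewrite /tiny /low => tz; move: N_ge60 tz; clear; nia. Qed.

Lemma high_term z : ~~ lowz z -> (dg z)^-1 - Dr^-1 <= ((Nr - 1) * Dr)^-1.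
Proof.
rewrite /low -ltnNge => zh; have a0 := deg_gt0 z; have D0 := Dr_gt0; have N60 := N_ge60R.
have {}zh : Nr * (Dr - dg z) < Dr by rewrite -natrB ?deg_leD // -natrM ltr_nat.
have N1 : 0 < Nr - 1 by lra.
have -> : (dg z)^-1 - Dr^-1 = (Dr - dg z) / (dg z * Dr) by field; rewrite !gt_eqF.
have -> : ((Nr - 1) * Dr)^-1 = (dg z / (Nr - 1)) / (dg z * Dr) by field; rewrite !gt_eqF.
rewrite ler_pM2r ?invr_gt0 ?mulr_gt0 // ler_pdivlMr //; lra.
Qed.

Lemma inv_term_ge0 z : 0 <= (dg z)^-1 - Dr^-1.
Proof. by rewrite subr_ge0 lef_pV2 ?posrE ?deg_gt0 ?Dr_gt0 // ler_nat deg_leD. Qed.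

Lemma pay_ge0 y : 0 <= pay y.
Proof.
rewrite /pay; have D0 := Dr_gt0; have N60 := N_ge60R.
by case: ifP => _; [|case: ifP => _ //]; apply: divr_ge0; lra.
Qed.

Lemma pay_cost y (m : nat) : (m <= #|lowsz y|)%N -> pay y * m%:R <= Nr^-1.
Proof.
move=> ms; have D0 := Dr_gt0; have N60 := N_ge60R.
have msr : m%:R <= #|lowsz y|%:R :> R by rewrite ler_nat.
have m0 : 0 <= m%:R :> R by [].
rewrite /pay; case: ifP => [h|_]; [|case: ifP => [h|_]].
- have {}h : 8 * Nr ^+ 2 * #|lowsz y|%:R <= Dr by rewrite -natrX -!natrM ler_nat.
  rewrite -[leRHS]div1r ler_pdivlMr; last lra.
  have -> : 8 * Nr / Dr * m%:R * Nr = (8 * Nr ^+ 2 * m%:R) / Dr by ring.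
  by rewrite ler_pdivrMr // mul1r; apply: le_trans h; rewrite ler_wpM2l ?mulr_ge0 ?exprn_ge0.
- have {}h : 4 * Nr * #|lowsz y|%:R <= Dr by rewrite -!natrM ler_nat.
  rewrite -[leRHS]div1r ler_pdivlMr; last lra.
  have -> : 4 / Dr * m%:R * Nr = (4 * Nr * m%:R) / Dr by ring.
  by rewrite ler_pdivrMr // mul1r; apply: le_trans h; rewrite ler_wpM2l ?mulr_ge0 ?exprn_ge0.
- by rewrite mul0r invr_ge0; lra.
Qed.

Lemma cost_le y : cost y <= delta.
Proof.
have D0 := Dr_gt0; have N60 := N_ge60R.
have h1 : pay y * #|[set z | [&& e y z, lowz z & ~~ tiny z]]|%:R <= Nr^-1.
  apply: pay_cost; apply: subset_leq_card; apply/subsetP => z.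
  by rewrite !inE => /and3P[-> -> _].
have h2 : \sum_(z | e y z && ~~ lowz z) ((dg z)^-1 - Dr^-1) <= (Nr - 1)^-1.
  apply: le_trans (_ : \sum_(z | e y z) ((Nr - 1) * Dr)^-1 <= _).
    rewrite [leRHS](bigID lowz) /= -[leLHS]add0r; apply: lerD.
      by apply: sumr_ge0 => z _; rewrite invr_ge0 mulr_ge0 //; lra.
    by apply: ler_sum => z /andP[_ zh]; apply: high_term.
  rewrite sumr_const -[leLHS]mulr_natl invfM mulrCA ger_pMr ?invr_gt0; last lra.
  rewrite ler_pdivrMr // mul1r ler_nat.
  apply: leq_trans (deg_leD y); apply: eq_leq; apply: eq_card => z; by rewrite inE.
have h3 : Nr^-1 <= (Nr - 1)^-1 by rewrite lef_pV2 ?posrE; lra.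
rewrite /cost /delta; have -> : 2 / (Nr - 1) = (Nr - 1)^-1 + (Nr - 1)^-1 by ring.
by apply: lerD => //; apply: le_trans h3.
Qed.

Lemma cost_lt y : cost y < eps.
Proof. exact: le_lt_trans (cost_le y) delta_eps. Qed.

Lemma inv_sum_ge0 y : 0 <= inv_sum y.
Proof. by apply: sumr_ge0 => z _; rewrite invr_ge0. Qed.

Lemma weight_ge0 y z : 0 <= weight y z.
Proof.
rewrite /weight; apply: addr_ge0; first by rewrite invr_ge0.
case: ifP => _; first by rewrite divr_ge0 ?subr_ge0 ?(ltW (cost_lt y)) ?mulr_ge0 ?inv_sum_ge0.
by case: ifP => _; [exact: pay_ge0 | exact: inv_term_ge0].
Qed.

Lemma base_sum y (P : pred T) : \sum_(z | e y z && P z) Dr^-1 <= 1.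
Proof.
rewrite sumr_const -[leLHS]mulr_natl ler_pdivrMr ?Dr_gt0 // mul1r ler_nat.
apply: leq_trans (deg_leD y); apply: subset_leq_card; apply/subsetP => z.
by rewrite !inE => /andP[].
Qed.

Lemma weight_sum_not_tiny y :
  \sum_(z | e y z && ~~ tiny z) weight y z = \sum_(z | e y z && ~~ tiny z) Dr^-1 + cost y.
Proof.
rewrite big_split /=; congr (_ + _); rewrite (bigID lowz) /= /cost; congr (_ + _).
  rewrite (eq_bigr (fun=> pay y)); last by move=> z /andP[/andP[_ /negPf->] ->].
  rewrite sumr_const -[LHS]mulr_natr; congr (_ * _%:R).
  by apply: eq_card => z; rewrite !inE unfold_in /= -andbA [~~ _ && _]andbC.
apply: eq_big => [z|z /andP[/andP[_ /negPf->] /negPf->] //].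
rewrite -andbA; congr (_ && _); case: (boolP (lowz z)); rewrite ?andbF // andbT.
by move=> h; apply: contra h; apply: tiny_low.
Qed.

Lemma weight_sum_le y : \sum_(z | e y z) weight y z <= 1 + eps.
Proof.
rewrite (bigID tiny) /= weight_sum_not_tiny.
rewrite big_split /= addrACA; apply: lerD.
  apply: le_trans (base_sum y predT); rewrite [leRHS](eq_bigl (e y)); last by move=> z; rewrite andbT.
  by rewrite [leRHS](bigID tiny).
rewrite -lerBrDr.
rewrite (eq_bigr (fun z => (eps - cost y) / inv_sum y * (dg z)^-1)); last first.
  by move=> z /andP[_ ->]; rewrite invfM -mulrA; congr (_ * _); rewrite mulrC.
rewrite -big_distrr /= -/(inv_sum y).
have [->|i0] := eqVneq (inv_sum y) 0; first by rewrite mulr0 subr_ge0 ltW // cost_lt.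
by rewrite divfK.
Qed.

Lemma weight_sum_not_tiny_lt y : \sum_(z | e y z && ~~ tiny z) weight y z < 1 + eps.
Proof. by rewrite weight_sum_not_tiny; apply: ler_ltD; [exact: base_sum | exact: cost_lt]. Qed.

(** A low [x] has more than [D / 4] neighbors. Either each of them pays at least [4 / D], or one has
    more than [D / (4 N)] low neighbors; then by [critical_few_lows] at least [D / (8 N)] of them
    pay [8 N / D]. *)
Lemma received_not_tiny x : ~~ tiny x -> 1 <= \sum_(y | e x y) weight y x.
Proof.
move=> xt; have D0 := Dr_gt0; have N60 := N_ge60R.
have degE (P : pred T) c : \sum_(y | e x y && P y) (c : R) = #|[set y | e x y && P y]|%:R * c.
  by rewrite sumr_const mulr_natl cardsE.
have [xl|xh] := boolP (lowz x); last first.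
  rewrite (eq_bigr (fun=> (dg x)^-1)); last first.
    by move=> y _; rewrite /weight (negPf xt) (negPf xh) addrC subrK.
  rewrite sumr_const -cardsE -[#|_|]/(degree e x) -[leRHS]mulr_natl divff //.
  by rewrite gt_eqF ?deg_gt0.
apply: le_trans (_ : \sum_(y | e x y) pay y <= _); last first.
  by apply: ler_sum => y _; rewrite /weight (negPf xt) xl lerDr invr_ge0.
have [y0 /andP[exy0 y0h]|none] := pickP [pred y | e x y && (D < 4 * N * #|lowsz y|)%N].
  have := critical_few_lows e_sym e_irr e_crit D_gt0 exy0 xl D_big N_ge60 y0h.
  set G := [set v | _] => DG.
  apply: le_trans (_ : \sum_(y | e x y && (8 * N ^ 2 * #|lowsz y| <= D)%N) (8 * Nr / Dr) <= _).
    rewrite degE -/G mulrA ler_pdivlMr // mul1r.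
    by rewrite -!natrM ler_nat mulnC.
  rewrite [leRHS](bigID (fun y => 8 * N ^ 2 * #|lowsz y| <= D)%N) /= -[leLHS]addr0.
  apply: lerD; last by apply: sumr_ge0 => y _; apply: pay_ge0.
  by apply: ler_sum => y /andP[_ h]; rewrite /pay h.
apply: le_trans (_ : \sum_(y | e x y) (4 / Dr) <= _).
  rewrite sumr_const -cardsE -[#|_|]/(degree e x) -[leRHS]mulr_natl mulrA ler_pdivlMr // mul1r.
  by rewrite -natrM ler_nat mulnC ltnW // ltnNge.
apply: ler_sum => y exy; rewrite /pay; have := none y; rewrite /= exy /= => /negbT.
rewrite -leqNgt => ->; case: ifP => // _; rewrite ler_pM2r ?invr_gt0 //; lra.
Qed.

Let lo := (D %/ 4)%N.

Lemma tinyE z : tiny z = (degree e z <= lo)%N.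
Proof. by rewrite /tiny /lo leq_divRL // mulnC. Qed.

Lemma received_tiny x : tiny x -> \sum_(y | e x y) weight y x =
  dg x / Dr + \sum_(y | e x y) (eps - cost y) / (dg x * inv_sum y).
Proof.
move=> xt; rewrite (eq_bigr (fun y => Dr^-1 + (eps - cost y) / (dg x * inv_sum y))); last first.
  by move=> y _; rewrite /weight xt.
rewrite big_split /=; congr (_ + _).
by rewrite sumr_const -cardsE -[#|_|]/(degree e x) -[LHS]mulr_natl.
Qed.

Lemma inv_sum_split x y : tiny x -> e x y -> dg x * inv_sum y =
  1 + \sum_(z in low_nbrs e x lo y) dg x / dg z.
Proof.
move=> xt exy; rewrite /inv_sum (bigD1 x) /=; last by rewrite e_sym exy xt.
rewrite mulrDr divff ?gt_eqF ?deg_gt0 //; congr (_ + _).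
rewrite big_distrr /=; apply: eq_bigl => z; rewrite inE tinyE andbAC -andbA.
by rewrite [(z != x) && _]andbC.
Qed.

Lemma inv_sum_gt0 x y : tiny x -> e x y -> 0 < dg x * inv_sum y.
Proof.
move=> xt exy; rewrite inv_sum_split // ltr_pwDl // sumr_ge0 // => z _.
by rewrite divr_ge0.
Qed.

Lemma sum_shares_le x (B : T -> R) c : tiny x -> c <= eps ->
  (forall y, e x y -> cost y <= c) ->
  (forall y, e x y -> dg x * inv_sum y <= B y) ->
  (eps - c) * \sum_(y | e x y) (B y)^-1 <=
  \sum_(y | e x y) (eps - cost y) / (dg x * inv_sum y).
Proof.
move=> xt ce cost_c BP; rewrite big_distrr /=; apply: ler_sum => y exy.
have p0 := inv_sum_gt0 xt exy; have BPy := BP y exy.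
apply: ler_pM.
- by rewrite subr_ge0.
- by rewrite invr_ge0; apply: le_trans BPy; apply: ltW.
- by rewrite lerD2l lerN2; apply: cost_c.
- by rewrite lef_pV2 ?posrE //; apply: lt_le_trans BPy.
Qed.

Lemma sum_const (P : pred T) (c : R) : \sum_(y | P y) c = #|[set y | P y]|%:R * c.
Proof. by rewrite sumr_const -cardsE -[LHS]mulr_natl. Qed.

Lemma tiny_threshold x : tiny x -> (degree e x + lo + lo + 2 <= D)%N.
Proof.
have := divn_eq D 4; rewrite -/lo; have : (8 <= D)%N.
  apply: leq_trans D_big; have : (0 < N ^ 6)%N by rewrite expn_gt0; move: N_ge60; case: (N).
  by clear; lia.
by rewrite tinyE; have := ltn_pmod D (isT : (0 < 4)%N); clear; lia.
Qed.

(** Here [m] counts the neighbors whose only tiny neighbor is [x]; each gives [x] its whole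
    [eps - cost]. By [ones_count], any other neighbor has at most [m - 1] further tiny neighbors,
    all of degree at least [d]. *)
Lemma received_many x : tiny x ->
  (forall m : nat, (2 <= m <= degree e x)%N ->
    1 <= (eps - delta) * (m%:R + (dg x - m%:R) / (1 + (m%:R - 1) * (dg x / d%:R)))) ->
  1 < \sum_(y | e x y) weight y x.
Proof.
move=> xt phi; have D0 := Dr_gt0; have k0 := deg_gt0 x.
have d0 : 0 < d%:R :> R by rewrite ltr0n; apply: leq_trans d_ge3.
pose a y := #|low_nbrs e x lo y|.
pose O := [set v | e x v && (a v == 0%N)].
have klo := tiny_threshold xt.
have aO y : e x y -> (2 <= #|O|)%N && (a y < #|O|)%N.
  by move=> exy; exact: (ones_count e_sym e_irr e_crit D_gt0 exy klo).
have [y0 exy0] : exists y, e x y.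
  by have := k0; rewrite ltr0n => /card_gt0P[y]; rewrite inE; exists y.
have [O2 _] := andP (aO y0 exy0).
have Ok : (#|O| <= degree e x)%N.
  by apply: subset_leq_card; apply/subsetP => v; rewrite !inE => /andP[].
pose q := 1 + (#|O|%:R - 1) * (dg x / d%:R).
have O2r : 2 <= #|O|%:R :> R by rewrite ler_nat.
have kd0 : 0 < dg x / d%:R by apply: divr_gt0.
have q0 : 0 < q by rewrite /q; nra.
have dle : delta <= eps by apply: ltW.
have S1 := sum_shares_le (B := fun y => if a y == 0%N then 1 else q) xt dle
  (fun y _ => cost_le y).
rewrite received_tiny //; have : 0 < dg x / Dr by apply: divr_gt0.
suff : 1 <= \sum_(y | e x y) (eps - cost y) / (dg x * inv_sum y).
  by move=> h kD; rewrite -[ltLHS]add0r; apply: ltr_leD.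
apply: le_trans (phi #|O| _) _; first by rewrite O2.
apply: le_trans (S1 _) => [|y exy].
  rewrite ler_pM2l ?subr_gt0 // (bigID (fun y => a y == 0%N)) /=.
  rewrite (eq_bigr (fun=> 1)) => [|y /andP[_ ->]]; last by rewrite invr1.
  rewrite [X in _ <= _ + X](eq_bigr (fun=> q^-1)) => [|y /andP[_ /negPf->] //].
  rewrite !sum_const mulr1 -/O -/q.
  have -> // : #|[set y | e x y && (a y != 0%N)]|%:R = dg x - #|O|%:R :> R.
  rewrite -natrB //; congr _%:R; rewrite /degree -(cardsID O [set v | e x v]).
  have -> : [set v | e x v] :&: O = O.
    by apply/setIidPr/subsetP => v; rewrite !inE => /andP[].
  rewrite addKn; apply: eq_card => v; rewrite !inE.
  by case: (e x v); rewrite ?andbT //= andbF.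
rewrite inv_sum_split // -/(a y); case: ifP => [/eqP/cards0_eq->|_].
  by rewrite big_set0 addr0.
rewrite /q lerD2l; have [_ ay] := andP (aO y exy).
apply: le_trans (_ : \sum_(z in low_nbrs e x lo y) dg x / d%:R <= _).
  apply: ler_sum => z _; rewrite ler_pM2l // lef_pV2 ?posrE ?deg_gt0 //.
  by rewrite ler_nat.
rewrite sumr_const -[leLHS]mulr_natl ler_pM2r // lerBrDr -/(a y).
by rewrite natr1 ler_nat.
Qed.

Lemma D_large : [/\ (4900 * N <= D)%N & (4900 * 3600 <= D)%N].
Proof.
have N0 : (0 < N)%N by apply: leq_trans N_ge60.
have N6 : (N ^ 2 <= N ^ 6)%N by apply: leq_pexp2l.
have N1 : (N <= N ^ 2)%N by rewrite -mulnn leq_pmulr.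
have N2 : (3600 <= N ^ 2)%N by rewrite -mulnn; apply: (@leq_mul 60 60).
split; apply: leq_trans D_big; rewrite leq_mul2l; apply/orP; right.
  exact: leq_trans N1 N6.
exact: leq_trans N2 N6.
Qed.

Lemma near_full_term z : (8 * (D - degree e z) <= degree e z)%N ->
  (dg z)^-1 - Dr^-1 <= (8 * Dr)^-1.
Proof.
have a0 := deg_gt0 z; have D0 := Dr_gt0.
rewrite -(ler_nat R) natrM natrB ?deg_leD // => zD.
have -> : (dg z)^-1 - Dr^-1 = (Dr - dg z) / (dg z * Dr) by field; rewrite !gt_eqF.
have -> : (8 * Dr)^-1 = (dg z / 8) / (dg z * Dr) by field; rewrite !gt_eqF.
by rewrite ler_pM2r ?invr_gt0 ?mulr_gt0 // ler_pdivlMr // mulrC.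
Qed.

(** The gap puts every neighbor of [y] that is not tiny within 2006 of the maximum degree, so none
    of them is low. At most 8 neighbors are below the maximum, each costing at most [1 / (8 D)]. *)
Lemma cost_no_mid x y mi : tiny x -> e x y -> (degree e x <= 4)%N -> (2000 <= lo)%N ->
  (D <= mi + 2006)%N -> (mi <= D)%N -> no_mid e x 2000 mi -> cost y <= Dr^-1.
Proof.
move=> xt exy x4 lo_ge Dmi miD nm; have [D1 D2] := D_large.
have not_tiny z : ~~ tiny z -> (2000 < degree e z)%N.
  by rewrite tinyE -ltnNge; apply: leq_trans; rewrite ltnS.
have far z : e y z -> ~~ tiny z -> (mi < degree e z)%N.
  move=> eyz zt; have zx : z != x by apply: contraNneq zt => ->.
  by have := nm y z exy eyz zx; rewrite not_tiny //= -ltnNge.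
have D0 := Dr_gt0.
rewrite /cost (_ : [set z | _] = set0) ?cards0 ?mulr0 ?add0r; last first.
  apply/setP => z; rewrite !inE; apply/negbTE/negP => /and3P[eyz zl zt].
  have zmi := far z eyz zt; move: zl; rewrite /low leqNgt => /negP; apply.
  apply: leq_trans D1; rewrite mulnC ltn_mul2r; apply/andP; split.
    by apply: leq_trans N_ge60.
  by move: zmi Dmi; clear; lia.
pose S := [set z | e y z && (degree e z < D)%N].
have cS : (#|S| <= 8)%N.
  apply: leq_trans (critical_deficient e_sym e_irr e_crit D_gt0 exy _) _.
    by move: x4 D2; clear; lia.
  by move: x4; clear; lia.
pose t : R := (8 * Dr)^-1.
have t0 : 0 <= t by rewrite invr_ge0 mulr_ge0.
apply: le_trans (_ : \sum_(z in S) t <= _).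
  rewrite [leLHS](bigID (fun z => degree e z < D)%N) /= [X in _ + X]big1 ?addr0; last first.
    move=> z /andP[_]; rewrite -leqNgt => Dz; have /eqP -> : degree e z == D.
      by rewrite eqn_leq Dz deg_leD.
    by rewrite subrr.
  rewrite [leRHS](bigID (fun z => ~~ lowz z)) /= -[leLHS]addr0; apply: lerD; last first.
    by apply: sumr_ge0.
  rewrite [leRHS](eq_bigl [pred z | (e y z && ~~ lowz z) && (degree e z < D)%N]); last first.
    by move=> z; rewrite !inE /= andbAC.
  apply: ler_sum => z /andP[/andP[eyz zl] _].
  have zmi : (mi < degree e z)%N by apply: far => //; apply: contra zl; apply: tiny_low.
  have zD : (8 * (D - degree e z) <= degree e z)%N by move: zmi Dmi D2; clear; lia.
  exact: near_full_term.
rewrite sumr_const -[leLHS]mulr_natl.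
apply: le_trans (_ : 8 * t <= _); first by rewrite ler_wpM2r // ler_nat.
by rewrite /t invfM mulrA divff ?mul1r // pnatr_eq0.
Qed.

Lemma received_tight x : tiny x -> degree e x = d -> (d <= 4)%N -> eps = 2 / (d%:R + 2) ->
  N = (12 * (d + 2))%N -> 1 < \sum_(y | e x y) weight y x.
Proof.
move=> xt xd d4 epsE NE; have D0 := Dr_gt0; have [D1 D2] := D_large.
(* The largest value that [critical_tight] allows with [lo] equal to 2000. *)
pose mi := (D - (d + 2002))%N.
have lo_ge : (2000 <= lo)%N by rewrite /lo leq_divRL; [move: D2; clear; lia | by []].
have lo_mi : (lo <= mi)%N.
  rewrite /mi /lo; have := divn_eq D 4; have := ltn_pmod D (isT : (0 < 4)%N).
  by move: D2 d4; clear; lia.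
have mi_ge : (2000 <= mi)%N by apply: leq_trans lo_mi.
have k34 : (2 < degree e x <= 4)%N by rewrite xd d_ge3 d4.
have kmi : (degree e x + 2000 + mi + 2 <= D)%N by rewrite xd /mi; move: D2 d4; clear; lia.
have kx : dg x = d%:R by rewrite xd.
have d0 : 0 < d%:R :> R by rewrite -kx deg_gt0.
pose a v := #|low_nbrs e x 2000 v|.
have term1 z : dg x / dg z <= 1.
  by rewrite ler_pdivrMr ?deg_gt0 // mul1r kx ler_nat.
have rec0 : 0 < dg x / Dr by rewrite divr_gt0 // kx.
rewrite received_tiny //.
have := critical_tight e_sym e_irr e_crit D_gt0 k34 kmi mi_ge; rewrite /= -/a.
set P := [set v | _].
have Pd : (#|P| <= d)%N.
  by rewrite -xd; apply: subset_leq_card; apply/subsetP => v; rewrite !inE => /andP[].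
have cardN : #|[set y | e x y && ~~ (0 < a y)%N]|%:R = d%:R - #|P|%:R :> R.
  rewrite -natrB //; congr _%:R; rewrite -{1}xd /degree -(cardsID P [set v | e x v]).
  have -> : [set v | e x v] :&: P = P.
    by apply/setIidPr/subsetP => v; rewrite !inE => /andP[].
  rewrite addKn; apply: eq_card => v; rewrite !inE.
  by case: (e x v); rewrite ?andbT //= andbF.
have sumP (f : T -> R) u v : (forall y, e x y -> (0 < a y)%N -> u <= f y) ->
    (forall y, e x y -> a y = 0%N -> v <= f y) ->
    #|P|%:R * u + (d%:R - #|P|%:R) * v <= \sum_(y | e x y) f y.
  move=> fu fv; rewrite [leRHS](bigID (fun y => 0 < a y)%N) /= -cardN -!sum_const.
  apply: lerD; apply: ler_sum => y /andP[exy ay]; first exact: fu.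
  by apply: fv => //; move: ay; rewrite lt0n negbK => /eqP.
(* The alternative without slack comes first. By the gap, [a y] counts all tiny neighbors of [y]
   except [x], and the shares add up to at least [(d - 2) / 2 + 2]. *)
case=> [[P1 P3 a2]|[P2 a1 nm]]; last first.
  have Dmi : (D <= mi + 2006)%N by rewrite /mi; move: D2 d4; clear; lia.
  have c1 y : e x y -> cost y <= Dr^-1.
    by move=> exy; apply: cost_no_mid xt exy _ lo_ge Dmi (leq_subr _ _) nm; rewrite xd.
  have Deps : Dr^-1 <= eps.
    rewrite epsE; apply: le_trans (_ : 4900^-1 <= _).
      rewrite lef_pV2 ?posrE // ler_nat; apply: leq_trans D1; apply: leq_pmulr.
      exact: leq_trans N_ge60.
    by apply: tight_share; rewrite ler0n ler_nat.
  have BP y : e x y -> dg x * inv_sum y <= 1 + (a y)%:R.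
    move=> exy; rewrite inv_sum_split // lerD2l /a -[leRHS]mulr1.
    apply: le_trans (_ : \sum_(z in low_nbrs e x lo y) 1 <= _).
      by apply: ler_sum => z _; apply: term1.
    rewrite sumr_const mulr1 ler_nat; apply: subset_leq_card; apply/subsetP => z.
    rewrite !inE => /and3P[eyz zx zlo]; rewrite eyz zx /= leqNgt; apply/negP => z2.
    by have := nm y z exy eyz zx; rewrite z2 (leq_trans zlo lo_mi).
  have S1 := sum_shares_le (B := fun y => 1 + (a y)%:R) xt Deps c1 BP.
  have S2 : #|P|%:R * 2^-1 + (d%:R - #|P|%:R) * 1 <= \sum_(y | e x y) (1 + (a y)%:R : R)^-1.
    apply: sumP => y exy ay; last by rewrite ay addr0 invr1.
    have -> : a y = 1%N by apply/eqP; rewrite eqn_leq a1.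
    by [].
  have P2r : #|P|%:R <= d%:R - 2 :> R by rewrite lerBrDr -natrD ler_nat; move: P2 d_ge3; rewrite xd; clear; lia.
  have d3r : 3 <= d%:R :> R by rewrite ler_nat.
  have {}S2 : d%:R / 2 + 1 <= \sum_(y | e x y) (1 + (a y)%:R : R)^-1.
    by apply: le_trans S2; apply: half_count.
  have {}S2 : (eps - Dr^-1) * (d%:R / 2 + 1) <= (eps - Dr^-1) * \sum_(y | e x y) (1 + (a y)%:R : R)^-1.
    by rewrite ler_wpM2l // subr_ge0.
  apply: lt_le_trans (lerD (lexx _) (le_trans S2 S1)).
  by rewrite kx epsE; apply: tight_value.
(* In the other alternative, tiny vertices of degree above 2000 add at most [d / 2000] each, and [y]
   has fewer than [d] tiny neighbors besides [x]. *)
pose eta : R := d%:R * (d%:R / 2000).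
have eta0 : 0 <= eta by rewrite mulr_ge0 // divr_ge0.
have BP y : e x y -> dg x * inv_sum y <= 1 + (a y)%:R + eta.
  move=> exy; rewrite inv_sum_split // -addrA lerD2l.
  rewrite (bigID (fun z => degree e z <= 2000)%N) /=; apply: lerD.
    apply: le_trans (_ : \sum_(z in low_nbrs e x lo y | (degree e z <= 2000)%N) 1 <= _).
      by apply: ler_sum => z _; apply: term1.
    rewrite sum_const mulr1 ler_nat; apply: subset_leq_card; apply/subsetP => z.
    by rewrite !inE => /andP[/and3P[-> -> _] ->].
  apply: le_trans (_ : \sum_(z in low_nbrs e x lo y) d%:R / 2000 <= _).
    rewrite [leRHS](bigID (fun z => degree e z <= 2000)%N) /= -[leLHS]add0r; apply: lerD.
      by apply: sumr_ge0 => z _; rewrite divr_ge0.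
    apply: ler_sum => z /andP[_]; rewrite -ltnNge => z2; rewrite kx ler_pM2l //.
    by rewrite lef_pV2 ?posrE ?deg_gt0 // ler_nat ltnW.
  rewrite sumr_const -[leLHS]mulr_natl /eta ler_wpM2r // ?divr_ge0 // ler_nat -xd.
  have /andP[_ aO] := ones_count e_sym e_irr e_crit D_gt0 exy (tiny_threshold xt).
  apply: leq_trans (ltnW aO) _; apply: subset_leq_card; apply/subsetP => v.
  by rewrite !inE => /andP[].
have S1 := sum_shares_le (B := fun y => 1 + (a y)%:R + eta) xt (ltW delta_eps) (fun y _ => cost_le y) BP.
have S2 : #|P|%:R * (3 + eta)^-1 + (d%:R - #|P|%:R) * (1 + eta)^-1 <=
    \sum_(y | e x y) (1 + (a y)%:R + eta)^-1.
  apply: sumP => y exy ay; last by rewrite ay addr0.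
  have ay2 : (a y)%:R <= 2 :> R by rewrite ler_nat a2.
  by apply: shifted_inv_le; rewrite ?ler0n.
suff key : 1 <= (eps - delta) * (#|P|%:R * (3 + eta)^-1 + (d%:R - #|P|%:R) * (1 + eta)^-1).
  rewrite -[ltLHS]add0r; apply: ltr_leD => //; apply: le_trans S1.
  by apply: le_trans key _; rewrite ler_wpM2l // subr_ge0 ltW.
rewrite /delta epsE NE /eta.
have [d3|d4'] : d = 3%N \/ d = 4%N by move: d_ge3 d4; clear; lia.
  rewrite P3 ?cards0 ?xd // d3 mul0r add0r subr0.
  have -> : (12 * (3 + 2))%:R - 1 = 59 :> R by rewrite -[(12 * _)%N]/60%N; ring.
  have -> : 3 + 2 = 5 :> R by ring.
  exact: slack3.
rewrite d4'.
have -> : (12 * (4 + 2))%:R - 1 = 71 :> R by rewrite -[(12 * _)%N]/72%N; ring.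
have -> : 4 + 2 = 6 :> R by ring.
by apply: slack4; rewrite ler0n -(ler_nat R) in P1 *.
Qed.

End Discharging.

(** * Lower bounds for the shares of a tiny vertex *)

Section ShareBounds.
Variable R : realFieldType.
Implicit Types d k m r : R.

(** The right side increases with [k], and its value at [k = d] is the left side. *)
Lemma share_ge m k d : 2 <= m -> m <= k -> d <= k -> 0 < d ->
  m - 1 + d / m <= m + (k - m) / (1 + (m - 1) * (k / d)).
Proof.
move=> m2 mk dk d0.
have q0 : 0 < d + (m - 1) * k by nra.
have -> : (k - m) / (1 + (m - 1) * (k / d)) = (k - m) * d / (d + (m - 1) * k).
  by field; rewrite !gt_eqF //; nra.
have -> : m - 1 + d / m = m + (d - m) / m by field; rewrite gt_eqF //; lra.
rewrite lerD2l ler_pdivrMr; last lra.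
rewrite mulrAC ler_pdivlMr //.
have : 0 <= (k - d) * (d + m * (m - 1)) by apply: mulr_ge0; nra.
by lra.
Qed.

(** The least value is [20 / 7], at [m = 2] and [k = 4]. *)
Lemma share3 (m : nat) k : (2 <= m)%N -> m%:R <= k -> 4 <= k ->
  1 <= (2 / 5 - 2 / 59) * (m%:R + (k - m%:R) / (1 + (m%:R - 1) * (k / 3))).
Proof.
move=> m2 mk k4.
suff h : 20 / 7 <= m%:R + (k - m%:R) / (1 + (m%:R - 1) * (k / 3)) by lra.
move: m2; rewrite leq_eqVlt => /predU1P[Em|m3].
  rewrite -Em -lerBlDl ler_pdivlMr; last lra.
  by lra.
have m3r : 3 <= m%:R :> R by rewrite ler_nat.
have : 0 <= (k - m%:R) / (1 + (m%:R - 1) * (k / 3)) by apply: divr_ge0; nra.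
by lra.
Qed.

(** The least value is [10 / 3], at [m = 2] and [k = 5]; the rounded [33 / 10] is enough. *)
Lemma share4 (m : nat) k : (2 <= m)%N -> m%:R <= k -> 5 <= k ->
  1 <= (2 / 6 - 2 / 71) * (m%:R + (k - m%:R) / (1 + (m%:R - 1) * (k / 4))).
Proof.
move=> m2 mk k5.
suff h : 33 / 10 <= m%:R + (k - m%:R) / (1 + (m%:R - 1) * (k / 4)) by lra.
move: m2; rewrite leq_eqVlt => /predU1P[Em|].
  rewrite -Em -lerBlDl ler_pdivlMr; last lra.
  by lra.
rewrite leq_eqVlt => /predU1P[Em|m4].
  rewrite -Em -lerBlDl ler_pdivlMr; last lra.
  by lra.
have m4r : 4 <= m%:R :> R by rewrite ler_nat.
have : 0 <= (k - m%:R) / (1 + (m%:R - 1) * (k / 4)) by apply: divr_ge0; nra.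
by lra.
Qed.

(* With [d = u ^ 2]: [m - 1 + d / m >= 2 u - 1] by AM-GM, while
   [r >= 3 u / 2] and hence [r (2 u - 1) >= 2 (d + 2)]. *)
Lemma share_large m u r : 4 <= u -> 2 <= m -> 0 <= r -> r ^+ 3 = (u ^+ 2 - 1) * u ^+ 2 ->
  1 <= r / (u ^+ 2 + 2) / 2 * (m - 1 + u ^+ 2 / m).
Proof.
move=> u4 m2 r0 r3.
have m0 : 0 < m by lra.
have am : 2 * u - 1 <= m - 1 + u ^+ 2 / m.
  rewrite -subr_ge0 (_ : _ - _ = (m - u) ^+ 2 / m); last by field; rewrite gt_eqF.
  by rewrite divr_ge0 ?sqr_ge0 // ltW.
have ru : 3 / 2 * u <= r.
  have p1 : 0 <= 3 / 2 * u by lra.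
  rewrite -(@ler_pXn2r _ 3) // r3 -subr_ge0.
  have -> : (u ^+ 2 - 1) * u ^+ 2 - (3 / 2 * u) ^+ 3 = u ^+ 2 * (u ^+ 2 - 27 / 8 * u - 1).
    by field.
  by rewrite mulr_ge0 ?sqr_ge0 //; nra.
have key : 2 * (u ^+ 2 + 2) <= r * (2 * u - 1).
  apply: le_trans (_ : 3 / 2 * u * (2 * u - 1) <= _); first by nra.
  by rewrite ler_wpM2r //; lra.
have s0 : 0 < u ^+ 2 + 2 by nra.
have -> : r / (u ^+ 2 + 2) / 2 * (m - 1 + u ^+ 2 / m) =
    r * (m - 1 + u ^+ 2 / m) / (2 * (u ^+ 2 + 2)).
  by field; rewrite !gt_eqF.
rewrite ler_pdivlMr ?mulr_gt0 // mul1r; apply: le_trans key _.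
exact: ler_wpM2l.
Qed.

End ShareBounds.

(** * Independent sets and the final choice of constants *)

Section IndependentSets.
Variables (T : finType) (e : rel T).

Lemma min_degree_le z : (min_degree e <= degree e z)%N.
Proof.
rewrite /min_degree; have : z \in index_enum T by apply: mem_index_enum.
elim: (index_enum T) => // x s IH; rewrite big_cons inE => /predU1P[->|/IH h].
  exact: geq_minl.
by apply: leq_trans h; apply: geq_minr.
Qed.

Lemma independence_number_attained :
  exists2 X : {set T}, independent e X & independence_number e = #|X|.
Proof.
have i0 : independent e set0 by apply/forall_inP => x; rewrite inE.
have [|X iX E] := @eq_bigmax_cond _ [pred S | independent e S] (fun S : {set T} => #|S|).
  by apply/card_gt0P; exists set0.
by exists X.
Qed.

Lemma independent_proper X : (0 < max_degree e)%N -> independent e X -> exists y, y \notin X.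
Proof.
move=> D0 iX; have [x x0] : exists x, (0 < degree e x)%N.
  apply/existsP; apply: contraLR D0 => /existsPn h; rewrite -leqNgt.
  by apply/bigmax_leqP => x _; rewrite leqNgt h.
move: x0 => /card_gt0P[y]; rewrite inE => exy.
have [xX|xX] := boolP (x \in X); last by exists x.
exists y; apply/negP => yX.
by move/forall_inP/(_ x xX)/forall_inP/(_ y yX): iX; rewrite exy.
Qed.

End IndependentSets.

Lemma independence_number_lt (R : realFieldType) (T : finType) (e : rel T) (N d : nat) (eps : R) :
  symmetric e -> irreflexive e -> Delta_critical e ->
  (60 <= N)%N -> (4900 * N ^ 6 <= max_degree e)%N -> (3 <= d)%N ->
  (forall z, d <= degree e z)%N -> 2 / (N%:R - 1) < eps ->
  (forall x, tiny e x -> 1 < \sum_(y | e x y) weight e N eps y x) ->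
  (independence_number e)%:R < (1 + eps) * (#|T|%:R - (independence_number e)%:R).
Proof.
move=> e_sym e_irr crit N60 big d3 deg eps0 rec.
have [X iX ->] := independence_number_attained e.
have D0 : (0 < max_degree e)%N.
  by apply: leq_trans big; rewrite muln_gt0 expn_gt0; apply/orP; left; apply: leq_trans N60.
have N1 : 0 < N%:R - 1 :> R by rewrite subr_gt0 ltr1n; apply: leq_trans N60.
have eps_ge0 : 0 <= eps by apply: ltW; apply: le_lt_trans eps0; rewrite divr_ge0 // ltW.
have -> : #|T|%:R - #|X|%:R = #|~: X|%:R :> R by rewrite -(cardsC X) natrD addrC addKr.
apply: (weight_bound (A := tiny e) e_sym (addr_ge0 ler01 eps_ge0) iX
  (independent_proper D0 iX) (weight := weight e N eps)).
- by move=> y z _; apply: weight_ge0 N60 big d3 deg eps0 y z.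
- exact: weight_sum_le N60 big d3 deg eps0.
- exact: weight_sum_not_tiny_lt N60 big d3 deg eps0.
- move=> x; have [/rec/ltW //|xt] := boolP (tiny e x).
  exact: received_not_tiny e_sym e_irr crit _ _ eps N60 big d3 deg x xt.
- exact: rec.
Qed.

Lemma leq_exp_threshold d a : (3 <= d)%N -> (a <= 5 * d + 4)%N ->
  (5 ^ a <= (d + 2) ^ (5 * d + 4))%N.
Proof.
move=> d3 ad; have b5 : (5 <= d + 2)%N by rewrite (leq_add2r 2 3).
apply: leq_trans (_ : (d + 2) ^ a <= _)%N; last first.
  by apply: leq_pexp2l; first exact: leq_trans b5.
by case: a {ad} => // a; rewrite leq_exp2r.
Qed.

(** Because [70 <= 5 ^ 3] and [12 <= 5 ^ 2]. *)
Lemma const_le_exp5 : (4900 * 12 ^ 6 <= 5 ^ (3 * 2 + 2 * 6))%N.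
Proof.
rewrite expnD; apply: leq_mul; rewrite expnM; last by rewrite leq_exp2r.
by rewrite -[4900%N]/(70 ^ 2)%N leq_exp2r.
Qed.

Lemma threshold_bound d D : (3 <= d)%N -> ((d + 2) ^ (5 * d + 10) <= D)%N ->
  (4900 * (12 * (d + 2)) ^ 6 <= D)%N.
Proof.
move=> d3; apply: leq_trans.
have -> : (5 * d + 10 = (5 * d + 4) + 6)%N by rewrite -addnA.
rewrite expnMn mulnA (expnD _ (5 * d + 4)) leq_mul2r; apply/orP; right.
apply: leq_trans const_le_exp5 (leq_exp_threshold d3 _).
by move: d3; clear; lia.
Qed.

Theorem theorem1p5 (R : realType) (d : nat) (T : finType) (e : rel T)
  (e_sym : symmetric e) (e_irr : irreflexive e)
  (d_gt0 : (0 < d)%N)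
  (e_crit : Delta_critical e)
  (min_deg : (d <= min_degree e)%N)
  (max_deg : ((d + 2) ^ (5 * d + 10) <= max_degree e)%N) :
  let n : R := #|T|%:R in
  let alpha : R := (independence_number e)%:R in
  let r : R := ((d%:R - 1) * d%:R) `^ 3^-1 in
  [/\ d = 3%N -> alpha < 7 * n / 12,
      d = 4%N -> alpha < 4 * n / 7
    & (19 <= d)%N ->
        alpha < (d%:R + 2 + r) / (2 * d%:R + 4 + r) * n].
Proof.
move=> n alpha r.
have deg z : (d <= degree e z)%N := leq_trans min_deg (min_degree_le e z).
have N60 : (3 <= d)%N -> (60 <= 12 * (d + 2))%N.
  by move=> d3; rewrite (@leq_mul 12 5) // (leq_add2r 2 3).
split=> [d3|d4|d19].
- have d3' : (3 <= d)%N by rewrite d3.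
  have NE : (12 * (d + 2))%:R - 1 = 59 :> R by rewrite d3 -[(12 * _)%N]/60%N; ring.
  have big := threshold_bound d3' max_deg.
  (* The fraction [(1 + eps) / (2 + eps)] is [7 / 12] at [eps = 2 / 5], and [4 / 7] at [eps = 2 / 6]
     in the next case. *)
  have eps0 : 2 / ((12 * (d + 2))%:R - 1) < 2 / 5 :> R by rewrite NE; lra.
  have := independence_number_lt e_sym e_irr e_crit (N60 d3') big d3' deg eps0.
  rewrite -/n -/alpha => H; suff : alpha < (1 + 2 / 5) * (n - alpha) by lra.
  apply: H => x xt; move: (deg x); rewrite leq_eqVlt => /predU1P[dx|dx].
    apply: (received_tight e_sym e_irr e_crit (N60 d3') big d3' deg eps0 xt) => //.
      by rewrite d3.
    by rewrite d3; congr (_ / _); ring.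
  apply: (received_many e_sym e_irr e_crit (N60 d3') big d3' deg eps0 xt).
  move=> m /andP[m2 mk]; rewrite NE d3; apply: share3 => //; first by rewrite ler_nat.
  by rewrite ler_nat -d3.
- have d3' : (3 <= d)%N by rewrite d4.
  have NE : (12 * (d + 2))%:R - 1 = 71 :> R by rewrite d4 -[(12 * _)%N]/72%N; ring.
  have big := threshold_bound d3' max_deg.
  have eps0 : 2 / ((12 * (d + 2))%:R - 1) < 2 / 6 :> R by rewrite NE; lra.
  have := independence_number_lt e_sym e_irr e_crit (N60 d3') big d3' deg eps0.
  rewrite -/n -/alpha => H; suff : alpha < (1 + 2 / 6) * (n - alpha) by lra.
  apply: H => x xt; move: (deg x); rewrite leq_eqVlt => /predU1P[dx|dx].
    apply: (received_tight e_sym e_irr e_crit (N60 d3') big d3' deg eps0 xt) => //.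
      by rewrite d4.
    by rewrite d4; congr (_ / _); ring.
  apply: (received_many e_sym e_irr e_crit (N60 d3') big d3' deg eps0 xt).
  move=> m /andP[m2 mk]; rewrite NE d4; apply: share4 => //; first by rewrite ler_nat.
  by rewrite ler_nat -d4.
have d3' : (3 <= d)%N by apply: leq_trans d19.
have big := threshold_bound d3' max_deg.
have d19r : 19 <= d%:R :> R by rewrite ler_nat.
have r3 : r ^+ 3 = (d%:R - 1) * d%:R.
  rewrite -powR_mulrn ?powR_ge0 // -powRrM mulVf ?pnatr_eq0 // powRr1 //.
  by apply: mulr_ge0; lra.
have r_ge0 : 0 <= r by apply: powR_ge0.
clearbody r; have r_ge1 : 1 <= r.
  by rewrite -(@ler_pXn2r _ 3) ?nnegrE // r3 expr1n; nra.
pose eps : R := r / (d%:R + 2).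
(* The shares need only half of [eps], so the other half may be lost to [cost]. *)
have del : 2 / ((12 * (d + 2))%:R - 1) <= eps / 2.
  rewrite natrM natrD /eps; move: (d%:R : R) d19r => x x19.
  rewrite -mulrA -invfM ler_pdivrMr; last lra.
  rewrite mulrAC ler_pdivlMr; last lra.
  by nra.
have eps_gt0 : 0 < eps by rewrite divr_gt0; lra.
have eps0 : 2 / ((12 * (d + 2))%:R - 1) < eps by lra.
have H : alpha < (1 + eps) * (n - alpha).
  apply: (independence_number_lt e_sym e_irr e_crit (N60 d3') big d3' deg eps0).
  move=> x xt; apply: (received_many e_sym e_irr e_crit (N60 d3') big d3' deg eps0 xt).
  move=> m /andP[m2 mk].
  have m2r : 2 <= m%:R :> R by rewrite ler_nat.
  have mkr : m%:R <= (degree e x)%:R :> R by rewrite ler_nat.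
  have dkr : d%:R <= (degree e x)%:R :> R by rewrite ler_nat.
  pose u := Num.sqrt (d%:R : R).
  have u2 : u ^+ 2 = d%:R by rewrite sqr_sqrtr //; lra.
  have u4 : 4 <= u.
    have u0 : 0 <= u := sqrtr_ge0 _.
    by rewrite -(@ler_pXn2r _ 2) ?nnegrE // u2; lra.
  have := @share_large _ m%:R u r u4 m2r r_ge0; rewrite u2 => /(_ r3) sl.
  have sg := share_ge m2r mkr dkr (lt_le_trans (ltr0n _ 19) d19r : 0 < d%:R).
  have e1 : 0 <= eps / 2 by lra.
  have e2 : 0 <= m%:R - 1 + d%:R / m%:R :> R.
    by apply: addr_ge0; [lra | exact: divr_ge0].
  have e3 : eps / 2 <= eps - 2 / ((12 * (d + 2))%:R - 1) by lra.
  exact: le_trans sl (ler_pM e1 e2 e3 sg).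
have s0 : 0 < d%:R + 2 :> R by lra.
have t0 : 0 < 2 * d%:R + 4 + r by lra.
rewrite mulrAC ltr_pdivlMr //.
have E : eps * (d%:R + 2) = r by rewrite /eps divfK // gt_eqF.
have : alpha * (d%:R + 2) < (1 + eps) * (n - alpha) * (d%:R + 2) by rewrite ltr_pM2r.
have -> : (1 + eps) * (n - alpha) * (d%:R + 2) = (d%:R + 2 + eps * (d%:R + 2)) * (n - alpha) by ring.
by rewrite E; lra.
Qed.
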